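(* There are positive constants $c_1,c_2$ such that for every fixed $d\geq 2$, almost surely (as $n\to\infty$) $$2^{c_1d}\, n \leq r(G(n,d/n)) \leq 2^{c_2 d\log^2 d}\, n.$$
   Context: The Ramsey number $r(H)$ of a graph $H$ is the least positive integer $N$ such that every two-coloring of the edges of $K_N$ contains a monochromatic copy of $H$. $G(n,p)$ is the random graph on $n$ labeled vertices in which each edge appears independently with probability $p$; almost surely means with probability tending to $1$ as $n\to\infty$. Logarithms are base $2$. *)

(* Defs.v *)
From HB Require Import structures.
From mathcomp Require Import all_boot all_order all_algebra.
From mathcomp Require Import reals exp.

Set Implicit Arguments.
Unset Strict Implicit.
Unset Printing Implicit Defensive.

Import GRing.Theory.

Definition pairs (T : finType) : {set {set T}} := [set e : {set T} | #|e| == 2].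

Record sgraph (T : finType) : predArgType := SGraph {
  edges : {set {set T}};
  edges_pairs : edges \subset pairs T
}.

HB.instance Definition _ (T : finType) := [isSub for @edges T].
HB.instance Definition _ (T : finType) := [Finite of sgraph T by <:].

(* A two-colouring of the edges of K_N is given by a function on all subsets of
   'I_N, of which only the values on two-element subsets matter: the image of
   an edge under the injection f is again a two-element set. *)
Definition monochromatic_copy (T : finType) (H : sgraph T) (N : nat)
    (c : {ffun {set 'I_N} -> bool}) : bool :=
  [exists f : {ffun T -> 'I_N}, exists b : bool,
    injectiveb f && [forall e in edges H, c (f @: e) == b]].

Definition ramsey_good (T : finType) (H : sgraph T) (N : nat) : bool :=
  (0 < N) && [forall c : {ffun {set 'I_N} -> bool}, monochromatic_copy H c].

Lemma ramsey_cliques (s t : nat) : exists N : nat,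
  forall (T : finType) (c : {set T} -> bool) (A : {set T}), N <= #|A| ->
  exists (B : {set T}) (b : bool), #|B| = (if b then s else t) /\
    B \subset A /\ {in B &, forall x y, x != y -> c [set x; y] = b}.
Proof.
elim: s t => [|s IHs] t.
  exists 0 => T c A _; exists set0, true.
  by rewrite cards0 sub0set; do 2!split=> //; move=> x y; rewrite inE.
elim: t => [|t [N2 IHt]].
  exists 0 => T c A _; exists set0, false.
  by rewrite cards0 sub0set; do 2!split=> //; move=> x y; rewrite inE.
have [N1 {}IHs] := IHs t.+1.
exists (N1 + N2).+1 => T c A leA.
have /card_gt0P[v vA] : 0 < #|A| by apply: leq_trans leA.
pose Nb b := [set x in A :\ v | c [set v; x] == b].
have NbP b x : x \in Nb b -> x != v /\ c [set v; x] = b.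
  by rewrite !inE => /andP[/andP[-> _] /eqP ->].
have cardN : N1 + N2 <= #|Nb true| + #|Nb false|.
  have -> : #|Nb true| + #|Nb false| = #|A :\ v|.
    rewrite -cardsUI (_ : Nb true :&: Nb false = set0) ?cards0 ?addn0.
      apply: eq_card => x; rewrite !inE.
      by case: (x == v) => //=; case: (x \in A) => //=; case: (c _).
    by apply/setP => x; rewrite !inE; case: (c _); rewrite ?andbF.
  by move: leA; rewrite (cardsD1 v) vA.
have NbA b : Nb b \subset A.
  by apply/subsetP => x; rewrite !inE => /andP[/andP[]].
have step b (B : {set T}) : B \subset Nb b ->
    {in B &, forall x y, x != y -> c [set x; y] = b} ->
    [/\ #|v |: B| = #|B|.+1, v |: B \subset A &
      {in v |: B &, forall x y, x != y -> c [set x; y] = b}].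
  move=> BNb Bc; have BN := subsetP BNb; split.
  - rewrite cardsU1; case: (boolP (v \in B)) => // /BN /NbP[].
    by rewrite eqxx.
  - by rewrite subUset sub1set vA (subset_trans BNb).
  - move=> x y /setU1P[->|xB] /setU1P[->|yB]; rewrite ?eqxx // => xy.
    + by have [] := NbP _ _ (BN _ yB).
    + by rewrite setUC; have [] := NbP _ _ (BN _ xB).
    + exact: Bc.
have [N1le|N2le] : N1 <= #|Nb true| \/ N2 <= #|Nb false|.
- case: (leqP N1 #|Nb true|) => [|lt1]; [by left|right].
  rewrite -(leq_add2l N1); apply: leq_trans cardN _.
  by rewrite leq_add2r ltnW.
- have [B [b [cB [BN Bc]]]] := IHs T c _ N1le; case: b cB Bc => cB Bc.
    have [cB' BA Bc'] := step _ _ BN Bc.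
    by exists (v |: B), true; rewrite cB' cB.
  by exists B, false; split=> //; split=> //; exact: subset_trans BN (NbA _).
- have [B [b [cB [BN Bc]]]] := IHt T c _ N2le; case: b cB Bc => cB Bc.
    by exists B, true; split=> //; split=> //; exact: subset_trans BN (NbA _).
  have [cB' BA Bc'] := step _ _ BN Bc.
  by exists (v |: B), false; rewrite cB' cB.
Qed.

Lemma ramsey_exists (T : finType) (H : sgraph T) :
  exists N : nat, ramsey_good H N.
Proof.
have [N RN] := ramsey_cliques #|T| #|T|; exists N.+1; apply/andP; split=> //.
apply/forallP => c.
have [|B [b [cB [_ Bc]]]] := RN _ c [set: 'I_N.+1].
  by rewrite cardsT card_ord.
have {}cB : #|T| = #|B| by rewrite cB; case: (b).
pose f := [ffun x : T => enum_val (cast_ord cB (enum_rank x))].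
have f_inj : injective f.
  by move=> x y; rewrite !ffunE => /enum_val_inj /cast_ord_inj /enum_rank_inj.
apply/existsP; exists f; apply/existsP; exists b; apply/andP; split.
  exact/injectiveP.
apply/forall_inP => e eH; move: (subsetP (edges_pairs H) e eH).
rewrite inE => /cards2P[x [y [xy ->]]]; rewrite imsetU1 imset_set1.
by rewrite Bc ?(inj_eq f_inj) // ffunE enum_valP.
Qed.

Definition ramsey (T : finType) (H : sgraph T) : nat :=
  ex_minn (ramsey_exists H).

Local Open Scope ring_scope.

(* This is a probability for 0 <= p <= 1. For p = d / n that holds as soon as
   d <= n, so limits as n tends to infinity are not affected. *)
Definition Gnp_prob (R : realType) (n : nat) (p : R)
    (E : pred (sgraph 'I_n)) : R :=
  \sum_(G : sgraph 'I_n | E G)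
    \prod_(e in pairs 'I_n) (if e \in edges G then p else 1 - p).
Arguments Gnp_prob {R} n p E.

Definition log2 (R : realType) (x : R) : R := ln x / ln 2.

(* Main.v *)
(** Upper bound.  With high probability every set [S] of at most [c n] vertices
    of [G(n, d/n)] spans fewer than [6|S|/5] edges, and all but few vertices have
    degree [O(d)].  Closing the set of high-degree vertices under "having two
    neighbours inside" gives a sparse core such that every other vertex has degree
    [O(d)] and at most one neighbour in the core.  In any two-colouring either the
    red graph is spread on a large set (a red neighbourhood fills a fixed proportion
    of every large subset, for most vertices), or, iterating [O(log d)] times, there
    is a large set of red density [O(1/d)].  In the second case a blue copy is found
    greedily, by degeneracy.  In the first case the core is embedded first: a sparse
    graph always has a vertex of degree at most 1 or two adjacent vertices of degree
    at most 2, and these can be embedded last; the other vertices are then embedded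
    one by one, keeping a large candidate set for each.

    Lower bound.  For large [d] colour the blow-up of the Hadamard colouring of the
    subsets of a [2q]-element set, with [q] proportional to [d].  By Lindsey's lemma
    any [n] vertices see a constant proportion of both colours, so a union bound over
    the maps to the [2^(2q)] blocks applies.  For bounded [d] use a red clique of
    [4n/5] vertices with all other edges blue: few vertices of [G(n, d/n)] are
    isolated, and it has no independent set of size [0.78 n]. *)

Require Import Defs.
From mathcomp Require Import all_boot all_order all_algebra.
From mathcomp Require Import reals sequences exp zify ring lra.

Set Implicit Arguments.
Unset Strict Implicit.
Unset Printing Implicit Defensive.

Import Order.TTheory GRing.Theory Num.Theory.

(** * Neighbourhoods, degree sums and choices from finite sets *)

Definition nbr (T : finType) (e : rel T) (C : {set T}) (x : T) : {set T} :=
  [set y in C | e x y].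

Definition degsum (T : finType) (e : rel T) (A B : {set T}) : nat :=
  \sum_(x in A) #|nbr e B x|.

Lemma sum_setU (T : finType) (A B : {set T}) (F : T -> nat) : [disjoint A & B] ->
  \sum_(x in A :|: B) F x = \sum_(x in A) F x + \sum_(x in B) F x.
Proof.
move=> dAB; rewrite (big_setID A) /= setUK setDUl setDv set0U; congr (_ + _).
by apply: eq_bigl => y; move: dAB; rewrite disjoint_sym => /setDidPl ->.
Qed.

Section Nbr.
Variables (T : finType) (e : rel T).
Implicit Types (A B C X Y : {set T}) (x y : T).

Lemma nbr_sub C x : nbr e C x \subset C.
Proof. by apply/subsetP => y; rewrite inE => /andP[]. Qed.

Lemma nbrS A B x : A \subset B -> #|nbr e A x| <= #|nbr e B x|.
Proof.
move=> /subsetP AB; apply: subset_leq_card; apply/subsetP => y.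
by rewrite !inE => /andP[/AB -> ->].
Qed.

Lemma card_nbrE C x : #|nbr e C x| = \sum_(y in C) e x y.
Proof.
rewrite -sum1_card [RHS](bigID (e x)) /= [X in _ + X]big1 ?addn0.
  by apply: eq_big => [y|y]; rewrite inE // => /andP[_ ->].
by move=> y /andP[_ /negPf ->].
Qed.

Lemma degsumC A B : symmetric e -> degsum e A B = degsum e B A.
Proof.
move=> se; rewrite /degsum.
under eq_bigr do rewrite card_nbrE.
rewrite exchange_big /=; apply: eq_bigr => y _; rewrite card_nbrE.
by apply: eq_bigr => x _; rewrite se.
Qed.

Lemma degsum_le k t A B : (forall x, x \in A -> k * #|nbr e B x| <= t) ->
  k * degsum e A B <= #|A| * t.
Proof.
move=> H; rewrite big_distrr -sum_nat_const; exact: leq_sum.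
Qed.

Lemma nbrUr A B x : [disjoint A & B] ->
  #|nbr e (A :|: B) x| = #|nbr e A x| + #|nbr e B x|.
Proof.
by move=> dAB; rewrite !card_nbrE sum_setU.
Qed.

Lemma degsumUU A B : symmetric e -> [disjoint A & B] ->
  degsum e (A :|: B) (A :|: B) =
    degsum e A A + degsum e B B + 2 * degsum e B A.
Proof.
move=> se dAB; rewrite /degsum.
under eq_bigr do rewrite (nbrUr _ dAB).
rewrite big_split /= !sum_setU //=.
by have := degsumC A B se; rewrite /degsum; lia.
Qed.

End Nbr.

Lemma exists_subset_card (T : finType) (A : {set T}) m : m <= #|A| ->
  exists2 B : {set T}, B \subset A & #|B| = m.
Proof.
move=> mA; have : 0 < #|[set B : {set T} | B \subset A & #|B| == m]|.
  by rewrite cards_draws bin_gt0.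
by case/card_gt0P => B; rewrite inE => /andP[BA /eqP]; exists B.
Qed.

Lemma exists_setD (T : finType) (A B : {set T}) : #|B| < #|A| ->
  exists2 w, w \in A & w \notin B.
Proof.
move=> BA; have : ~~ (A \subset B).
  by apply: contraL BA => /subset_leq_card; rewrite -leqNgt.
by case/subsetPn => w; exists w.
Qed.

(** * A large spread set or a sparse set *)

Section Dichotomy.
Variables (T : finType) (e : rel T) (k Q : nat).
Implicit Types (C X Y : {set T}).

Definition low C X := [set w in X | k * #|nbr e C w| < #|C|].

(** The single parameter [Q] governs both the least size of a test set and the number of exceptional
    vertices, so a larger [Q] is a stronger requirement. *)
Definition spread X := [forall C : {set T},
  (C \subset X) && (#|X| <= Q * #|C|) ==> (Q * #|low C X| < #|X|)].

Lemma spreadP X : reflect (forall C, C \subset X -> #|X| <= Q * #|C| ->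
  Q * #|low C X| < #|X|) (spread X).
Proof.
apply: (iffP forallP) => [H C CX cC|H C].
  by have := H C; rewrite CX cC.
by apply/implyP => /andP[]; apply: H.
Qed.

(** Induction on [h]. If [X] is not spread, some large [C] has many low vertices; [B] consists of
    such vertices and [W] is the rest of [C]. A sparse [Y1] found in [B] is joined to a sparse [Y2]
    found among the vertices of [W] with few neighbours in [Y1]. The union has twice the size and
    cross density at most [4 / k], so the density bound [1 / 2 ^ h + 4 / k] passes from [h] to
    [h + 1]. *)
Lemma spread_or_sparse m h X : symmetric e -> 0 < m -> 0 < Q ->
  m * (4 * Q) ^ h <= #|X| ->
  (exists X', m * (4 * Q) <= #|X'| /\ spread X') \/
  (exists Y, #|Y| = 2 ^ h * m /\ Y \subset X /\
    k * 2 ^ h * degsum e Y Y <= (k + 4 * 2 ^ h) * #|Y| ^ 2).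
Proof.
move=> se m0 Q0; elim: h X => [|h IH] X.
  (* For [h = 0] the density bound is at least 1, and any [m] vertices do. *)
  rewrite expn0 muln1 => /exists_subset_card[Y YX cY]; right; exists Y.
  rewrite expn0 mul1n cY; split=> //; split=> //.
  have := @degsum_le T e 1 m Y Y; rewrite cY !mul1n muln1 => H.
  have : degsum e Y Y <= m * m.
    by apply: H => x _; rewrite mul1n -cY subset_leq_card ?nbr_sub.
  by nia.
move=> cX; have [sX|] := boolP (spread X).
  left; exists X; split=> //; apply: leq_trans cX.
  rewrite leq_mul2l expnS leq_pmulr ?orbT //.
  by rewrite expn_gt0; lia.
case/forallPn => C; rewrite negb_imply -leqNgt => /andP[/andP[CX cC] cB].
set M := m * (4 * Q) ^ h.
have cXM : Q * (4 * M) <= #|X|.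
  by apply: leq_trans cX; rewrite /M expnS; lia.
have MB : 4 * M <= #|low C X|.
  by rewrite -(leq_pmul2l Q0); apply: leq_trans cB.
have MC : 4 * M <= #|C|.
  by rewrite -(leq_pmul2l Q0); apply: leq_trans cC.
have [|B BL cBM] := @exists_subset_card _ (low C X) M; first by lia.
have cW : #|C| <= #|C :\: B| + M.
  by rewrite -cBM -(cardsID B C) addnC leq_add2l subset_leq_card // subsetIr.
set W := C :\: B in cW.
have degB x : x \in B -> k * #|nbr e W x| <= 2 * #|W|.
  move=> /(subsetP BL); rewrite inE => /andP[_ xk].
  have := nbrS e x (subsetDl C B); rewrite -/W => le1.
  have : k * #|nbr e W x| <= k * #|nbr e C x| by rewrite leq_mul2l le1 orbT.
  by lia.
have [] := IH B; [by rewrite cBM|by left|].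
case=> Y1 [cY1 [Y1B dY1]]; set a := 2 ^ h * m in cY1.
have a0 : 0 < a by rewrite muln_gt0 expn_gt0 m0.
have dWY : k * degsum e W Y1 <= a * (2 * #|W|).
  rewrite degsumC // -cY1; apply: degsum_le => x /(subsetP Y1B).
  exact: degB.
(* By averaging, at most half of [W] has more than [4 * a / k] neighbours in [Y1]. The factor 4 in
   [4 * Q] ensures that [W'] still has at least [M] elements. *)
pose W' := [set w in W | k * #|nbr e Y1 w| <= 4 * a].
have cWW' : 2 * #|W :\: W'| <= #|W|.
  have : 4 * a * #|W :\: W'| <= a * (2 * #|W|).
    apply: leq_trans dWY; rewrite /degsum (big_setID W') /= mulnDr.
    apply: leq_trans (leq_addl _ _).
    rewrite mulnC -sum_nat_const big_distrr /=; apply: leq_sum => w.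
    rewrite !inE => /andP[wN wW]; move: wN wW.
    by rewrite negb_and => /orP[/negP//|]; rewrite -ltnNge => /ltnW.
  by nia.
have cW' : M <= #|W'|.
  have := cardsID W' W; rewrite (_ : W :&: W' = W').
    by move: cWW' cW MC; lia.
  by apply/setIidPr/subsetP => w; rewrite inE => /andP[].
have [] := IH W'; [exact: cW'|by left|].
case=> Y2 [cY2 [Y2W dY2]].
have d12 : [disjoint Y1 & Y2].
  apply: disjointWl Y1B _; apply: disjointWr Y2W _.
  rewrite -setI_eq0; apply/eqP/setP => x; rewrite !inE.
  by case: (x \in B); rewrite //= andbF.
right; exists (Y1 :|: Y2).
have -> : #|Y1 :|: Y2| = 2 ^ h.+1 * m.
  by rewrite cardsU disjoint_setI0 // cards0 subn0 cY1 cY2 expnS /a; lia.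
split=> //; split.
  rewrite subUset; apply/andP; split.
    apply: subset_trans Y1B _; apply: subset_trans BL _.
    by apply/subsetP => x; rewrite inE => /andP[].
  apply: subset_trans Y2W _; apply: subset_trans CX.
  by apply/subsetP => x; rewrite !inE => /andP[/andP[_ ->]].
rewrite degsumUU //.
have d21 : k * degsum e Y2 Y1 <= a * (4 * a).
  rewrite -{1}(_ : #|Y2| = a) //; apply: degsum_le => x /(subsetP Y2W).
  by rewrite inE => /andP[].
have -> : 2 ^ h.+1 * m = 2 * a by rewrite expnS /a; lia.
move: dY1 dY2; rewrite cY1 cY2 -/a (expnS 2) -(mulnn a) -(mulnn (2 * a)).
move: (degsum e Y1 Y1) (degsum e Y2 Y2) (degsum e Y2 Y1) d21 (2 ^ h) => o1 o2 o3.
move=> d21 p d1 d2.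
have d3 : k * o3 * (4 * p) <= a * (4 * a) * (4 * p) by rewrite leq_mul2r d21 orbT.
by clear -d1 d2 d3; clearbody a; nia.
Qed.

End Dichotomy.

(** * Partial embeddings and the greedy embedding into a sparse set *)

Section PartialEmbedding.
Variables (H T : finType) (g : rel H).
Hypotheses (g_sym : symmetric g) (g_irr : irreflexive g).

(** The relation [r] is a parameter because red copies use [e] and blue copies its complement. The
    map [f] is total, but only its values on [S] matter. *)
Definition pembed (r : rel T) (P : {set T}) (S : {set H}) (f : H -> T) : Prop :=
  [/\ {in S &, injective f}, {in S, forall x, f x \in P} &
      {in S &, forall x y, g x y -> r (f x) (f y)}].

Definition extend (f : H -> T) (v : H) (w : T) (x : H) : T :=
  if x == v then w else f x.

Lemma extend_id f v w : extend f v w v = w.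
Proof. by rewrite /extend eqxx. Qed.

Lemma extend_in (S : {set H}) f v w x : v \notin S -> x \in S ->
  extend f v w x = f x.
Proof. by rewrite /extend => vS xS; case: eqP => // xv; rewrite -xv xS in vS. Qed.

Lemma pembed_extend r P S f v w : symmetric r -> pembed r P S f ->
  v \notin S -> w \in P -> w \notin f @: S ->
  {in S, forall u, g u v -> r (f u) w} ->
  pembed r P (v |: S) (extend f v w).
Proof.
move=> r_sym [fi fP fr] vS wP wf wr.
have wN u : u \in S -> f u != w.
  by move=> uS; apply: contra wf => /eqP <-; apply: imset_f.
split=> [x y|x|x y].
- move=> /setU1P[->|xS] /setU1P[->|yS] //; rewrite ?extend_id ?(extend_in _ _ vS) //.
  + by move=> /esym /eqP; rewrite (negPf (wN _ yS)).
  + by move=> /eqP; rewrite (negPf (wN _ xS)).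
  + exact: fi.
- by move=> /setU1P[->|xS]; rewrite ?extend_id ?(extend_in _ _ vS) //; apply: fP.
- move=> /setU1P[->|xS] /setU1P[->|yS]; rewrite ?extend_id ?(extend_in _ _ vS) //.
  + by rewrite g_irr.
  + by rewrite g_sym r_sym; apply: wr.
  + exact: wr.
  + exact: fr.
Qed.

Lemma pembed0 (t0 : T) r P : pembed r P set0 (fun=> t0).
Proof. by split=> x; rewrite inE. Qed.

Lemma card_bigcup_le (I : finType) (A : {set I}) (F : I -> {set T}) t :
  (forall i, i \in A -> #|F i| <= t) -> #|\bigcup_(i in A) F i| <= #|A| * t.
Proof.
move=> Ft; rewrite -sum_nat_const.
elim/big_rec2: _ => [|i n B /Ft Fi IH]; first by rewrite cards0.
by apply: leq_trans (leq_add Fi IH); rewrite cardsU leq_subr.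
Qed.

(** A vertex of degree at most [D] is removed, the rest embedded, and the vertex put back. By
    averaging, three quarters of [Y] lie in [Y'], where [e]-degrees are at most [#|Y| / (4 * D)].
    Used vertices exclude at most a quarter of [Y], and so do the [e]-neighbours of the at most [D]
    relevant images. *)
Lemma embed_sparse (t0 : T) (e : rel T) (Y : {set T}) D :
  symmetric e -> 0 < D ->
  (forall S : {set H}, S != set0 -> exists2 v, v \in S & #|nbr g S v| <= D) ->
  16 * D * degsum e Y Y <= #|Y| ^ 2 -> 0 < #|Y| -> 4 * #|H| <= #|Y| ->
  exists f : H -> T, pembed (fun x y => ~~ e x y) Y setT f.
Proof.
move=> e_sym D0 degen dY Y0 HY.
pose Y' := [set y in Y | 4 * D * #|nbr e Y y| <= #|Y|].
have Y'Y : Y' \subset Y by apply/subsetP => y; rewrite inE => /andP[].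
have cY' : 3 * #|Y| <= 4 * #|Y'|.
  have : #|Y| * #|Y :\: Y'| <= 4 * D * degsum e Y Y.
    rewrite /degsum (big_setID Y') /= mulnDr; apply: leq_trans (leq_addl _ _).
    rewrite mulnC -sum_nat_const big_distrr /=; apply: leq_sum => w.
    rewrite !inE => /andP[wN wY]; move: wN; rewrite wY /= -ltnNge.
    exact: ltnW.
  have := cardsID Y' Y; rewrite (_ : Y :&: Y' = Y'); last exact/setIidPr.
  rewrite -mulnn in dY; move=> c1 c2; clear -dY Y0 c1 c2.
  have c3 : #|Y| * (4 * #|Y :\: Y'|) <= #|Y| * #|Y|.
    by apply: leq_trans dY; rewrite mulnCA; apply: leq_trans (leq_mul (leqnn 4) c2) _; lia.
  by rewrite leq_pmul2l // in c3; lia.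
suff emb (S : {set H}) : exists f, pembed (fun x y => ~~ e x y) Y' S f.
  have [f [fi fP fr]] := emb setT; exists f; split=> //.
  by move=> x /fP; apply: (subsetP Y'Y).
have [m] := ubnP #|S|; elim: m S => // m IH S; rewrite ltnS => Sm.
have [->|/degen[v vS dv]] := eqVneq S set0.
  by exists (fun=> t0); apply: pembed0.
have [|f fE] := IH (S :\ v).
  by move: Sm; rewrite (cardsD1 v) vS.
have [fi fP _] := fE.
pose forb := f @: (S :\ v) :|: \bigcup_(u in nbr g (S :\ v) v) nbr e Y (f u).
have : #|forb| < #|Y'|.
  have c1 : #|f @: (S :\ v)| <= #|H|.
    exact: leq_trans (leq_imset_card _ _) (max_card _).
  have c2 : 4 * D * #|\bigcup_(u in nbr g (S :\ v) v) nbr e Y (f u)| <= D * #|Y|.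
    have dv' : #|nbr g (S :\ v) v| <= D.
      exact: leq_trans (nbrS _ _ (subsetDl _ _)) dv.
    have [->|[u0 u0N]] := set_0Vmem (nbr g (S :\ v) v).
      by rewrite big_set0 cards0 muln0.
    pose t := #|Y| %/ (4 * D).
    have : #|\bigcup_(u in nbr g (S :\ v) v) nbr e Y (f u)| <= #|nbr g (S :\ v) v| * t.
      apply: card_bigcup_le => u; rewrite inE => /andP[/fP].
      by rewrite inE => /andP[_ H1] _; rewrite leq_divRL ?muln_gt0 // mulnC.
    have := leq_divM #|Y| (4 * D); rewrite -/t => tY le1.
    have le2 := leq_trans le1 (leq_mul dv' (leqnn t)).
    by apply: leq_trans (leq_mul (leqnn _) le2) _; rewrite mulnCA leq_mul2l mulnC tY orbT.
  have := leq_card_setU (f @: (S :\ v)) (\bigcup_(u in nbr g (S :\ v) v) nbr e Y (f u)).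
  have {c2}c2 : 4 * #|\bigcup_(u in nbr g (S :\ v) v) nbr e Y (f u)| <= #|Y|.
    by rewrite -(leq_pmul2l D0) mulnA [D * 4]mulnC.
  by rewrite -/forb => -[c3 _]; clear -c1 c2 c3 cY' HY Y0; lia.
case/exists_setD => w wY'; rewrite inE negb_or => /andP[wf /bigcupP wN].
exists (extend f v w).
rewrite -(setD1K vS); apply: pembed_extend => //.
- by move=> x y; rewrite e_sym.
- by rewrite !inE eqxx.
- move=> u uS guv; apply/negP => euw; apply: wN; exists u.
    by rewrite inE uS g_sym.
  by rewrite inE euw (subsetP Y'Y).
Qed.

End PartialEmbedding.

(** Otherwise all degrees are at least 2 and all neighbours of degree-2 vertices have degree at
    least 3. The degree sum [t] over the vertices of degree at least 3 is then at least [2 * #|S2|]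
    and at least [3 * #|S :\: S2|], so [5 * t >= 2 * #|S2| + 12 * #|S :\: S2|], which contradicts
    the average degree being below [12 / 5]. *)
Lemma sparse_reducible (H : finType) (g : rel H) (S : {set H}) :
  symmetric g -> S != set0 -> 5 * degsum g S S < 12 * #|S| ->
  (exists2 v, v \in S & #|nbr g S v| <= 1) \/
  (exists x y, [/\ x \in S, y \in S, g x y, #|nbr g S x| <= 2 & #|nbr g S y| <= 2]).
Proof.
move=> g_sym S0 sp.
have [/existsP[v /andP[]]|H1] := boolP [exists v, (v \in S) && (#|nbr g S v| <= 1)].
  by left; exists v.
have [/existsP[x /existsP[y /and5P[]]]|H2] := boolP [exists x, exists y,
    [&& x \in S, y \in S, g x y, #|nbr g S x| <= 2 & #|nbr g S y| <= 2]].
  by right; exists x, y.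
have deg2 v : v \in S -> 2 <= #|nbr g S v|.
  move=> vS; rewrite ltnNge; apply: contra H1 => d1.
  by apply/existsP; exists v; rewrite vS.
have deg3 x y : x \in S -> y \in S -> g x y -> #|nbr g S x| <= 2 -> 2 < #|nbr g S y|.
  move=> xS yS gxy d1; rewrite ltnNge; apply: contra H2 => d2.
  by apply/existsP; exists x; apply/existsP; exists y; apply/and5P.
pose S2 := [set v in S | #|nbr g S v| <= 2].
have eS : degsum g S S = degsum g S2 S + degsum g (S :\: S2) S.
  rewrite {1}/degsum (big_setID S2) /= (_ : S :&: S2 = S2) //.
  by apply/setIidPr/subsetP => x; rewrite inE => /andP[].
have cS : #|S| = #|S2| + #|S :\: S2|.
  rewrite -(cardsID S2 S) (_ : S :&: S2 = S2) //.
  by apply/setIidPr/subsetP => x; rewrite inE => /andP[].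
have h1 : 2 * #|S2| <= degsum g S2 S.
  rewrite mulnC -sum_nat_const; apply: leq_sum => x.
  by rewrite inE => /andP[/deg2].
have h2 : degsum g S2 S <= 2 * #|S2|.
  rewrite -[X in X <= _]mul1n mulnC [2 * _]mulnC mulnC; apply: degsum_le => x.
  by rewrite inE mul1n => /andP[].
have h3 : degsum g S2 S <= degsum g (S :\: S2) S.
  have -> : degsum g S2 S = degsum g S2 (S :\: S2).
    apply: eq_bigr => x; rewrite inE => /andP[xS d2]; congr #|pred_of_set _|.
    apply/setP => y; rewrite !inE; case yS: (y \in S) => //=.
    rewrite andbT; case gxy: (g x y); rewrite ?andbF //= andbT -ltnNge.
    by rewrite (deg3 x y).
  rewrite degsumC //; apply: leq_sum => x _; apply: nbrS.
  by apply/subsetP => y; rewrite inE => /andP[].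
have h4 : 3 * #|S :\: S2| <= degsum g (S :\: S2) S.
  rewrite mulnC -sum_nat_const; apply: leq_sum => x.
  by rewrite !inE => /andP[xN xS]; rewrite xS -ltnNge in xN.
by lia.
Qed.

(** * Embedding into a spread set: the core first, then the other vertices *)

Section SpreadEmbedding.
Variables (H T : finType) (g : rel H) (e : rel T) (X : {set T}) (k Q : nat).
Hypotheses (g_sym : symmetric g) (g_irr : irreflexive g) (e_sym : symmetric e).
Hypotheses (k0 : 0 < k) (Xk : spread e k Q X) (X0 : 0 < #|X|).
Implicit Types (S : {set H}) (C : {set T}) (f : H -> T) (u v : H) (w : T).

Definition cand S f u := [set w in X | [forall a in S, g a u ==> e (f a) w]].

Lemma candP S f u w :
  reflect (w \in X /\ {in S, forall a, g a u -> e (f a) w}) (w \in cand S f u).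
Proof.
rewrite inE; apply: (iffP andP) => -[wX H1]; split=> //.
  by move=> a aS ga; have /forall_inP/(_ a aS)/implyP/(_ ga) := H1.
by apply/forall_inP => a aS; apply/implyP; apply: H1.
Qed.

(** Core vertices are placed in [fine], so a vertex with a single embedded neighbour there keeps at
    least [#|X| / k] candidates. *)
Let fine := X :\: low e k X X.

Lemma fine_deg w : w \in fine -> #|X| <= k * #|nbr e X w|.
Proof. by rewrite !inE => /andP[wN wX]; rewrite wX -leqNgt in wN. Qed.

Lemma cand_fine S f u : pembed g e fine S f -> #|nbr g S u| <= 1 ->
  #|X| <= k ^ #|nbr g S u| * #|cand S f u|.
Proof.
move=> [_ fP _]; rewrite leq_eqVlt ltnS leqn0 => /orP[/cards1P[a eN]|/eqP/cards0_eq eN].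
  have aN b : (b \in S) && g u b = (b == a) by rewrite -in_set1 -eN inE.
  have /andP[aS _] : (a \in S) && g u a by rewrite aN.
  rewrite eN cards1 expn1 (_ : cand S f u = nbr e X (f a)); first exact: fine_deg (fP _ aS).
  apply/setP => w; apply/candP/idP => [[wX H1]|].
    by rewrite inE wX H1 // g_sym; have := aN a; rewrite aS eqxx /= => ->.
  rewrite inE => /andP[wX ew]; split=> // b bS gb.
  by have := aN b; rewrite bS g_sym gb /= => /esym/eqP ->.
rewrite eN cards0 mul1n subset_leq_card //; apply/subsetP => w wX.
apply/candP; split=> // a aS ga; have : a \in nbr g S u by rewrite inE aS g_sym.
by rewrite eN inE.
Qed.

Lemma card_low C : C \subset X -> #|X| <= Q * #|C| -> Q * #|low e k C X| < #|X|.
Proof. exact: (spreadP _ _ _ _ Xk). Qed.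

(** Of the [a] candidates at most a quarter are already images and fewer than three quarters are
    low, so one remains. *)
Lemma room x n l a : 4 * n * k ^ 2 <= x -> 4 * k ^ 2 * l < 3 * x ->
  x <= k ^ 2 * a -> n + l < a.
Proof.
have : 0 < k ^ 2 by rewrite expn_gt0 k0.
by move: (k ^ 2) => K; nia.
Qed.

Lemma imset_le_card f S : #|f @: S| <= #|H|.
Proof. exact: leq_trans (leq_imset_card _ _) (max_card _). Qed.

(** Induction on the core, with the reducible configuration of [sparse_reducible] embedded last. Its
    vertices then see at most one embedded vertex each, hence have at least [#|X| / k] candidates.
    Placing an adjacent pair one vertex after the other costs a second factor [k], whence
    [k ^ 2]. *)
Lemma embed_sparse_part (t0 : T) (S0 : {set H}) :
  4 * k ^ 2 <= Q -> 4 * #|H| * k ^ 2 <= #|X| ->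
  (forall S, S \subset S0 -> S != set0 -> 5 * degsum g S S < 12 * #|S|) ->
  exists f, pembed g e fine S0 f.
Proof.
move=> kQ HX sp.
have k2 : k <= k ^ 2 by rewrite -mulnn leq_pmulr.
have lowX : 4 * k ^ 2 * #|low e k X X| < #|X|.
  apply: leq_ltn_trans (card_low (subxx _) _); first by rewrite leq_mul2r kQ orbT.
  by apply: leq_pmull; apply: leq_trans kQ; rewrite muln_gt0 expn_gt0 k0.
have [m] := ubnP #|S0|; elim: m S0 sp => // m IH S sp; rewrite ltnS => Sm.
have [->|Sn0] := eqVneq S set0.
  by exists (fun=> t0); apply: pembed0.
have spS := sp S (subxx _) Sn0.
have [[v vS dv]|[x [y [xS yS gxy dx dy]]]] := sparse_reducible g_sym Sn0 spS.
  have [||f fE] := IH (S :\ v).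
  - by move=> S' S'S; apply: sp; apply: subset_trans S'S (subsetDl _ _).
  - by move: Sm; rewrite (cardsD1 v) vS.
  have dv' : #|nbr g (S :\ v) v| <= 1.
    exact: leq_trans (nbrS _ _ (subsetDl _ _)) dv.
  have cA := cand_fine fE dv'.
  have [|w wc] := @exists_setD _ (cand (S :\ v) f v) (f @: (S :\ v) :|: low e k X X).
    have [+ _] := leq_card_setU (f @: (S :\ v)) (low e k X X).
    move=> /leq_ltn_trans; apply.
    apply: leq_ltn_trans (leq_add (imset_le_card _ _) (leqnn _)) _.
    apply: room HX _ _; first by apply: leq_trans lowX _; rewrite leq_pmull.
    apply: leq_trans cA _; rewrite leq_mul2r; apply/orP; right.
    by case: #|_| dv' => [|[|]] // _; rewrite expn_gt0 k0.
  rewrite inE negb_or => /andP[wf wl].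
  have /candP[wX wr] := wc.
  exists (extend f v w); rewrite -(setD1K vS); apply: pembed_extend => //.
  - by rewrite !inE eqxx.
  - by rewrite inE wl.
pose S' := S :\ x :\ y.
have xy : x != y by apply: contraTneq gxy => ->; rewrite g_irr.
have yS' : y \in S :\ x by rewrite !inE eq_sym xy.
have S'S : S' \subset S by apply: subset_trans (subsetDl _ _) (subsetDl _ _).
have [||f fE] := IH S'.
- by move=> S'' S''S; apply: sp; apply: subset_trans S'S.
- by move: Sm; rewrite (cardsD1 x) xS (cardsD1 y (S :\ x)) yS' -/S'; lia.
have xS'N : x \notin S' by rewrite !inE eqxx /= andbF.
have yS'N : y \notin x |: S' by rewrite !inE eqxx /= orbF eq_sym.
have deg1 u u' : u' \in S -> u' \notin S' -> g u u' -> #|nbr g S u| <= 2 ->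
    #|nbr g S' u| <= 1.
  move=> u'S u'S' guu' d2; rewrite -ltnS; apply: leq_trans d2.
  apply: proper_card; apply/properP; split.
    by apply/subsetP => z; rewrite !inE => /andP[/and3P[_ _ ->]].
  exists u'; first by rewrite inE u'S.
  by rewrite inE (negPf u'S').
have yS'N0 : y \notin S' by rewrite !inE eqxx.
have cA := cand_fine fE (deg1 x y yS yS'N0 gxy dx).
have cB : #|X| <= k * #|cand S' f y|.
  have dy1 : #|nbr g S' y| <= 1 by apply: (deg1 y x); rewrite // g_sym.
  apply: leq_trans (cand_fine fE dy1) _; rewrite leq_mul2r; apply/orP; right.
  by case: #|_| dy1 => [|[]].
have cA' : #|X| <= k ^ 2 * #|cand S' f x|.
  apply: leq_trans cA _; rewrite leq_mul2r; apply/orP; right.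
  by have := deg1 x y yS yS'N0 gxy dx; case: #|_| => [|[]] // _; rewrite expn_gt0 k0.
set A := cand S' f x in cA'; set B := cand S' f y in cB.
have BX : B \subset X by apply/subsetP => w; rewrite inE => /andP[].
have lowB : 4 * k ^ 2 * #|low e k B X| < #|X|.
  apply: leq_ltn_trans (card_low BX _); first by rewrite leq_mul2r kQ orbT.
  apply: leq_trans cB _; rewrite leq_mul2r; apply/orP; right.
  by apply: leq_trans kQ; apply: leq_trans k2 (leq_pmull _ _).
(* The image of [x] also avoids the low vertices for [B], so that at least a proportion [1 / k] of
   the candidates of [y] is adjacent to it. *)
have [|w wA] := @exists_setD _ A (f @: S' :|: (low e k X X :|: low e k B X)).
  have [+ _] := leq_card_setU (f @: S') (low e k X X :|: low e k B X).
  have [+ _] := leq_card_setU (low e k X X) (low e k B X).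
  move=> le2 /leq_ltn_trans; apply.
  apply: leq_ltn_trans (leq_add (imset_le_card _ _) le2) _.
  apply: room HX _ cA'; rewrite mulnDr; clear -lowX lowB; move: lowX lowB.
  by move: (_ * _) (4 * _ * _) #|X| => a b c; lia.
rewrite !inE !negb_or => /andP[wf /andP[wl wB]].
have /candP[wX wr] := wA.
rewrite wX /= -leqNgt in wB; rewrite wX /= in wl.
have wfine : w \in fine by rewrite !inE wX wl.
have f'E := pembed_extend g_sym g_irr e_sym fE xS'N wfine wf wr.
set f' := extend f x w in f'E.
have cC : #|X| <= k ^ 2 * #|nbr e B w|.
  by apply: leq_trans cB _; rewrite -mulnn -mulnA leq_mul2l wB orbT.
have [|w2 w2B] := @exists_setD _ (nbr e B w) (f' @: (x |: S') :|: low e k X X).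
  have [+ _] := leq_card_setU (f' @: (x |: S')) (low e k X X).
  move=> /leq_ltn_trans; apply.
  apply: leq_ltn_trans (leq_add (imset_le_card _ _) (leqnn _)) _.
  by apply: room HX _ cC; apply: leq_trans lowX _; rewrite leq_pmull.
rewrite inE negb_or => /andP[w2f w2l].
move: w2B; rewrite inE => /andP[/candP[w2X w2r] eww2].
exists (extend f' y w2).
have -> : S = y |: (x |: S').
  by rewrite setUCA [y |: _]setD1K // setD1K.
apply: pembed_extend => //; first by rewrite inE w2l.
move=> u /setU1P[->|uS'] guy; first by rewrite /f' extend_id.
by rewrite /f' (extend_in f w xS'N uS') w2r.
Qed.

(** The invariant: an unembedded vertex with [i] embedded neighbours has at least [#|X| / k ^ i]
    candidates. It holds initially because such a vertex sees at most one core vertex, whose image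
    is fine. The bound on [Q] makes every candidate set a valid test set for [spread] and lets the
    at most [D] low sets to be avoided cover at most a quarter of the candidates. *)
Lemma embed_spread (S0 : {set H}) D : 0 < D ->
  (forall u, u \notin S0 -> #|nbr g setT u| <= D /\ #|nbr g S0 u| <= 1) ->
  4 * D * k ^ D <= Q -> 4 * #|H| * k ^ D <= #|X| ->
  forall f0, pembed g e fine S0 f0 -> exists f, pembed g e X setT f.
Proof.
move=> D0 degD DQ HX f0 f0E.
have kD0 : 0 < k ^ D by rewrite expn_gt0 k0.
suff main m S f : #|~: S| = m -> S0 \subset S -> pembed g e X S f ->
    (forall u, u \notin S -> #|X| <= k ^ #|nbr g S u| * #|cand S f u|) ->
    exists f, pembed g e X setT f.
  apply: (main _ S0 f0 erefl) => // [|u uS0].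
    case: f0E => fi fP fr; split=> // x /fP.
    by rewrite inE => /andP[].
  by apply: cand_fine => //; case: (degD u uS0).
elim: m S f => [|m IH] S f cS S0S fE candS.
  exists f; suff <- : S = setT by [].
  by apply/eqP; rewrite -subTset -setCS setCT subset0 -cards_eq0 cS.
have /card_gt0P[v] : 0 < #|~: S| by rewrite cS.
rewrite inE => vS.
have degS u : u \notin S -> #|nbr g S u| <= D.
  move=> uS; have [|+ _] := degD u; first by apply: contra uS; apply: (subsetP S0S).
  by apply: leq_trans; apply: nbrS.
have candD u : u \notin S -> #|X| <= k ^ D * #|cand S f u|.
  move=> uS; apply: leq_trans (candS u uS) _; rewrite leq_mul2r; apply/orP; right.
  by rewrite leq_pexp2l // degS.
(* Besides the used vertices, the image of [v] must avoid the low vertices for the candidate set of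
   every neighbour of [v] still to come. *)
pose forb := f @: S :|: \bigcup_(u in nbr g (~: S) v) low e k (cand S f u) X.
have [|w wc] := @exists_setD _ (cand S f v) forb.
  have [+ _] := leq_card_setU (f @: S)
    (\bigcup_(u in nbr g (~: S) v) low e k (cand S f u) X).
  rewrite -/forb => c1.
  pose t := #|X| %/ Q.
  have c2 : #|\bigcup_(u in nbr g (~: S) v) low e k (cand S f u) X| <= D * t.
    have : #|nbr g (~: S) v| <= D.
      have [|+ _] := degD v; first by apply: contra vS; apply: (subsetP S0S).
      by apply: leq_trans; apply: nbrS.
    move=> /(leq_mul (m1 := _)) => /(_ t t (leqnn _)) /(leq_trans _); apply.
    apply: card_bigcup_le => u; rewrite inE => /andP[uS _].
    rewrite inE in uS.
    rewrite leq_divRL; last by apply: leq_trans DQ; rewrite !muln_gt0 kD0 D0.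
    rewrite mulnC ltnW // card_low //; first by apply/subsetP => z /candP[].
    apply: leq_trans (candD u uS) _; rewrite leq_mul2r; apply/orP; right.
    by apply: leq_trans DQ; rewrite leq_pmull // muln_gt0 D0.
  have := leq_divM #|X| Q; rewrite -/t => tX.
  have := candD v vS; have := imset_le_card f S.
  move=> c3 c4.
  have c5 : 4 * (k ^ D * (D * t)) <= #|X|.
    by apply: leq_trans tX; rewrite [t * Q]mulnC; apply: leq_trans (leq_mul DQ (leqnn t)); lia.
  have : k ^ D * (#|f @: S| + #|\bigcup_(u in nbr g (~: S) v) low e k (cand S f u) X|)
     <= k ^ D * (#|H| + D * t) by rewrite leq_mul2l leq_add ?orbT.
  move=> c6; rewrite -(ltn_pmul2l kD0); apply: leq_trans c4.
  apply: leq_ltn_trans (leq_trans (leq_mul (leqnn _) c1) c6) _.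
  by rewrite mulnDr; move: HX c5 X0; rewrite -mulnA [#|H| * _]mulnC; lia.
rewrite inE negb_or => /andP[wf wl].
have /candP[wX wr] := wc.
have f'E := pembed_extend g_sym g_irr e_sym fE vS wX wf wr.
apply: (IH (v |: S) (extend f v w)) => //.
- have := cardsC S; have := cardsC (v |: S); rewrite cardsU1 vS cS /=; lia.
- exact: subset_trans S0S (subsetUr _ _).
move=> u; rewrite !inE negb_or => /andP[uv uS].
have candE : cand (v |: S) (extend f v w) u =
    if g u v then nbr e (cand S f u) w else cand S f u.
  apply/setP => z; apply/candP/idP => [[zX zr]|].
    have zc : z \in cand S f u.
      apply/candP; split=> // a aS gau; rewrite -(extend_in f w vS aS).
      by apply: zr; rewrite // inE aS orbT.
    case guv: (g u v) => //; rewrite inE zc -(extend_id f v w).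
    by apply: zr; rewrite ?inE ?eqxx // g_sym.
  case: ifP => guv; last move=> /candP[zX zr].
    rewrite inE => /andP[/candP[zX zr] ewz]; split=> // a /setU1P[->|aS] ga.
      by rewrite extend_id.
    by rewrite (extend_in f w vS aS) zr.
  split=> // a /setU1P[->|aS] ga; first by rewrite g_sym guv in ga.
  by rewrite (extend_in f w vS aS) zr.
have nbrE : #|nbr g (v |: S) u| = g u v + #|nbr g S u|.
  case guv: (g u v).
    rewrite (_ : nbr g (v |: S) u = v |: nbr g S u) ?cardsU1 ?inE ?(negPf vS) //.
    by apply/setP => z; rewrite !inE; case: eqP => // ->; rewrite guv.
  congr #|pred_of_set _|; apply/setP => z; rewrite !inE.
  by case: eqP => // ->; rewrite guv !andbF.
rewrite nbrE candE; case guv: (g u v); last exact: candS.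
apply: leq_trans (candS u uS) _; rewrite add1n expnS mulnAC [k * _ * _]mulnC mulnC.
rewrite mulnC leq_mul2l; apply/orP; right.
rewrite leqNgt; apply: contra wl => wl; apply/bigcupP; exists u.
  by rewrite !inE uS g_sym.
by rewrite inE wX.
Qed.

End SpreadEmbedding.

(** * The sparse core around the high-degree vertices *)

Section HighDegreeCore.
Variables (H : finType) (g : rel H) (M D : nat).
Hypothesis g_sym : symmetric g.

Definition high_degree : {set H} := [set v | D < #|nbr g setT v|].

Definition locally_sparse : bool := [forall S : {set H},
  (S != set0) && (#|S| <= M) ==> (5 * degsum g S S < 12 * #|S|)].

(* Absorbing vertices with two neighbours inside adds two edges per vertex, so
   local sparsity bounds the size of the closure of the high-degree vertices. *)
Lemma high_degree_core : 0 < M -> locally_sparse -> 4 * #|high_degree| <= M ->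
  exists S0 : {set H},
    (forall u, u \notin S0 -> #|nbr g setT u| <= D /\ #|nbr g S0 u| <= 1) /\
    (forall S : {set H}, S \subset S0 -> S != set0 -> 5 * degsum g S S < 12 * #|S|).
Proof.
move=> M0 /forallP spb hM; set T0 := high_degree in hM.
have sp S : S != set0 -> #|S| <= M -> 5 * degsum g S S < 12 * #|S|.
  by move=> S0 SM; have := spb S; rewrite S0 SM.
pose P (S : {set H}) := [&& T0 \subset S, #|S| <= M &
  4 * #|S| <= degsum g S S + 4 * #|T0|].
have /ex_maxset[S /maxsetP[/and3P[T0S SM dS] Smax]] : exists S, P S.
  by exists T0; apply/and3P; split=> //; [apply: leq_trans hM; rewrite leq_pmull|
    rewrite leq_addl].
have S5 : 2 * #|S| <= 5 * #|T0|.
  have [->|S0] := eqVneq S set0; first by rewrite cards0.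
  by move: (sp S S0 SM) dS; clear; lia.
have S1M : #|S| < M.
  have [T00|T00] := posnP #|T0|; first by rewrite T00 muln0 in S5; lia.
  by clear -S5 T00 hM; lia.
exists S; split=> [u uS|S' S'S S'0]; last first.
  by apply: sp => //; apply: leq_trans SM; apply: subset_leq_card.
split.
  by rewrite leqNgt; apply: contra uS => du; apply: (subsetP T0S); rewrite inE.
rewrite leqNgt; apply/negP => du.
have /Smax /(_ (subsetUr _ _)) uSE : P (u |: S).
  rewrite /P cardsU1 uS (subset_trans T0S (subsetUr _ _)) /= S1M /=.
  have dis : [disjoint S & [set u]].
    by rewrite disjoint_sym disjoints1.
  rewrite setUC degsumUU // [degsum g [set u] S]big_set1.
  by move: dS du; clear; lia.
by move: uS; rewrite -uSE !inE eqxx.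
Qed.

End HighDegreeCore.


(** * The deterministic upper bound on the Ramsey number *)

Lemma ramsey_dichotomy (H T : finType) (g : rel H) (e : rel T) M D h :
  symmetric g -> irreflexive g -> symmetric e -> 0 < #|H| ->
  0 < M -> locally_sparse g M -> 4 * #|high_degree g D| <= M ->
  1 < D -> 32 * D <= 2 ^ h ->
  4 * #|H| * (16 * D * (128 * D) ^ D) ^ h <= #|T| ->
  exists f : H -> T, injective f /\
    ((forall x y, g x y -> e (f x) (f y)) \/ (forall x y, g x y -> ~~ e (f x) (f y))).
Proof.
move=> g_sym g_irr e_sym H0 M0 sp hM D1 Dh HT.
have [S0 [S0deg S0sp]] := high_degree_core g_sym M0 sp hM.
have D0 := ltnW D1.
(* This [k] makes [4 / k] equal to [1 / (32 * D)], and [32 * D <= 2 ^ h] bounds the other density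
   term by the same amount; the sum is the density [1 / (16 * D)] that [embed_sparse] requires. [Q]
   is the least value that [embed_spread] allows. *)
set k := 128 * D in HT; set Q := 4 * D * k ^ D.
have k0 : 0 < k by rewrite muln_gt0.
have kD0 : 0 < k ^ D by rewrite expn_gt0 k0.
have Q0 : 0 < Q by rewrite !muln_gt0 D0.
have kDQ : k ^ D <= Q by rewrite leq_pmull // muln_gt0.
have T0 : 0 < #|T|.
  by apply: leq_trans HT; rewrite muln_gt0 muln_gt0 H0 expn_gt0 !muln_gt0 D0 kD0.
have /card_gt0P[t0 _] := T0.
have HTX : 4 * #|H| * (4 * Q) ^ h <= #|[set: T]|.
  by rewrite cardsT; apply: leq_trans HT; rewrite /Q !mulnA.
have m0 : 0 < 4 * #|H| by rewrite muln_gt0.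
have [[X [cX sX]]|[Y [cY [_ dY]]]] := spread_or_sparse k e_sym m0 Q0 HTX.
  have X0 : 0 < #|X| by apply: leq_trans cX; rewrite muln_gt0 m0 muln_gt0 Q0.
  have HkX : 4 * #|H| * k ^ D <= #|X|.
    by apply: leq_trans cX; rewrite leq_mul2l (leq_trans kDQ) ?orbT // leq_pmull.
  (* Since [D >= 2], the size requirements of the core embedding follow from those of the second
     phase. *)
  have k2D : k ^ 2 <= k ^ D by rewrite leq_pexp2l.
  have [||f0 f0E] := embed_sparse_part g_sym g_irr e_sym k0 sX X0 t0 _ _ S0sp.
  - by rewrite /Q leq_mul // leq_pmulr.
  - by apply: leq_trans HkX; rewrite leq_mul2l k2D orbT.
  have [f [fi _ fr]] := embed_spread g_sym g_irr e_sym k0 sX X0 D0 S0deg (leqnn _) HkX f0E.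
  exists f; split; first by move=> x y; apply: fi; rewrite inE.
  by left=> x y; apply: fr; rewrite inE.
(* A vertex outside the core has degree at most [D]; a set inside the core has average degree below
   [12 / 5], hence a vertex of degree at most 2. *)
have degen (S : {set H}) : S != set0 -> exists2 v, v \in S & #|nbr g S v| <= D.
  move=> Sn0; have [SS0|/subsetPn[v vS vS0]] := boolP (S \subset S0); last first.
    exists v => //; have [+ _] := S0deg v vS0.
    by apply: leq_trans; apply: nbrS (subsetT _).
  have [/existsP[v /andP[vS dv]]|H1] := boolP [exists v, (v \in S) && (#|nbr g S v| <= 2)].
    by exists v => //; apply: leq_trans dv D1.
  have : 3 * #|S| <= degsum g S S.
    rewrite mulnC -sum_nat_const; apply: leq_sum => v vS.
    by rewrite ltnNge; apply: contra H1 => dv; apply/existsP; exists v; rewrite vS.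
  have := S0sp S SS0 Sn0; have : 0 < #|S| by rewrite card_gt0.
  by clear; lia.
have [|||f [fi _ fr]] := embed_sparse (Y := Y) g_sym g_irr t0 e_sym D0 degen.
- move: dY; rewrite /k; clear -Dh; move: (degsum e Y Y) (#|Y| ^ 2) => o y.
  move: (2 ^ h) Dh => p Dp dY.
  have [p0|p0] := posnP p; first by have -> : D = 0 by lia.
  have : 8 * p * (16 * D * o) <= 8 * p * y.
    have -> : 8 * p * (16 * D * o) = 128 * D * p * o by lia.
    by apply: leq_trans dY _; rewrite leq_mul2r; lia.
  by rewrite leq_pmul2l // muln_gt0.
- by rewrite cY !muln_gt0 expn_gt0 H0.
- by rewrite cY leq_pmull // expn_gt0.
exists f; split; first by move=> x y; apply: fi; rewrite inE.
by right=> x y; apply: fr; rewrite inE.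
Qed.

Definition adj (T : finType) (G : sgraph T) : rel T :=
  fun u v => [set u; v] \in edges G.

Lemma adj_sym (T : finType) (G : sgraph T) : symmetric (adj G).
Proof. by move=> u v; rewrite /adj setUC. Qed.

Lemma adj_irr (T : finType) (G : sgraph T) : irreflexive (adj G).
Proof.
move=> u; apply/negP => /(subsetP (edges_pairs G)).
by rewrite inE setUid cards1.
Qed.

Lemma edgeP (T : finType) (G : sgraph T) (a : {set T}) : a \in edges G ->
  exists u v, [/\ u != v, a = [set u; v] & adj G u v].
Proof.
move=> aG; have := subsetP (edges_pairs G) _ aG.
rewrite inE => /cards2P[u [v [uv aE]]]; exists u, v.
by rewrite /adj -aE.
Qed.

Lemma imset_set2 (aT rT : finType) (f : aT -> rT) x y :
  f @: [set x; y] = [set f x; f y].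
Proof. by rewrite imsetU1 imset_set1. Qed.

Lemma ramsey_le (T : finType) (G : sgraph T) N : ramsey_good G N -> ramsey G <= N.
Proof. by rewrite /ramsey; case: ex_minnP => m _; apply. Qed.

Lemma ramsey_goodP (T : finType) (G : sgraph T) : ramsey_good G (ramsey G).
Proof. by rewrite /ramsey; case: ex_minnP. Qed.

Lemma ramsey_upper (T : finType) (G : sgraph T) M D h : 0 < #|T| -> 0 < M ->
  locally_sparse (adj G) M -> 4 * #|high_degree (adj G) D| <= M ->
  1 < D -> 32 * D <= 2 ^ h ->
  ramsey G <= 4 * #|T| * (16 * D * (128 * D) ^ D) ^ h.
Proof.
move=> T0 M0 sp hM D1 Dh; apply: ramsey_le; set N := _ * _.
apply/andP; split.
  by rewrite !muln_gt0 T0 expn_gt0 !muln_gt0 expn_gt0 muln_gt0 (ltnW D1).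
apply/forallP => c; pose e (x y : 'I_N) := c [set x; y].
have e_sym : symmetric e by move=> x y; rewrite /e setUC.
have NE : N <= #|'I_N| by rewrite card_ord.
have [f [fi fc]] := ramsey_dichotomy (@adj_sym _ G) (@adj_irr _ G) e_sym T0 M0 sp hM D1 Dh NE.
have fE : finfun f =1 f by move=> x; rewrite ffunE.
apply/existsP; exists (finfun f); apply/existsP.
have inj : injectiveb (finfun f).
  by apply/injectiveP => x y; rewrite !ffunE; apply: fi.
case: fc => fc; [exists true|exists false]; rewrite inj /=; apply/forall_inP => a.
all: move=> /edgeP[u [v [_ -> uv]]]; rewrite imset_set2 !fE -/(e _ _).
  by rewrite fc.
by rewrite (negPf (fc _ _ uv)).
Qed.

(** * Binomial estimates *)

Lemma bin_le_expn2 n k : 'C(n, k) <= 2 ^ n.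
Proof.
elim: n k => [|n IH] [|k] //; first by rewrite bin0 expn_gt0.
by rewrite binS expnS mul2n -addnn leq_add.
Qed.

(** Each factor of [(2 * f) ^_ f] is at least [f], and the binomial coefficient of [2 * f] over [f]
    is at most [4 ^ f]. *)
Lemma expnn_le_fact f : f ^ f <= 4 ^ f * f`!.
Proof.
apply: leq_trans (_ : (2 * f) ^_ f <= _).
  rewrite ffact_prod -[X in _ ^ X]card_ord -prod_nat_const.
  by apply: leq_prod => i _; have := ltn_ord i; lia.
rewrite -bin_ffact leq_mul2r; apply/orP; right.
by have -> : 4 = 2 ^ 2 by []; rewrite -expnM bin_le_expn2.
Qed.

(** A division-free form of the usual bound, with 4 in place of Euler's number. *)
Lemma bin_mul_expnn_le m f : 'C(m, f) * f ^ f <= (4 * m) ^ f.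
Proof.
apply: leq_trans (leq_mul (leqnn _) (expnn_le_fact f)) _.
rewrite mulnCA bin_ffact expnMn leq_mul2l; apply/orP; right.
rewrite ffact_prod -[X in _ ^ X]card_ord -prod_nat_const.
by apply: leq_prod => i _; rewrite leq_subr.
Qed.

(** * From degree conditions to numbers of edges *)

Section EdgeCounts.
Variables (T : finType).
Implicit Types (S B : {set T}) (G : sgraph T).

Lemma adj_neq G x y : adj G x y -> x != y.
Proof. by apply: contraTneq => ->; rewrite adj_irr. Qed.

(** Double counting: every edge in [A] is seen from at most its two endpoints. *)
Lemma degsum_adj_le G (A : {set {set T}}) S B :
  (forall x y, x \in S -> y \in B -> adj G x y -> [set x; y] \in A) ->
  degsum (adj G) S B <= 2 * #|A :&: edges G|.
Proof.
move=> SBA; set F := A :&: edges G.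
have nbrF x : x \in S -> #|nbr (adj G) B x| <= \sum_(e in F) (x \in e).
  move=> xS; have xN y : y \in nbr (adj G) B x -> x != y.
    by rewrite inE => /andP[_ /adj_neq].
  rewrite -(card_in_imset (f := fun y => [set x; y])) => [|y z /xN xy /xN xz E].
    rewrite -sum1_card big_mkcond [X in _ <= X]big_mkcond /=.
    apply: leq_sum => e _; case: imsetP => // -[y yB ->].
    have := yB; rewrite inE => /andP[yB' xy].
    have -> : [set x; y] \in F by rewrite inE SBA.
    by rewrite set21.
  have : y \in [set x; z] by rewrite -E in_set2 eqxx orbT.
  by rewrite in_set2 => /orP[/eqP yx|/eqP//]; rewrite yx eqxx in xy.
apply: (@leq_trans (\sum_(x in S) \sum_(e in F) (x \in e))).
  by apply: leq_sum => x; apply: nbrF.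
rewrite exchange_big /= mulnC -sum_nat_const; apply: leq_sum => e.
rewrite inE => /andP[_ /(subsetP (edges_pairs G))]; rewrite inE => /eqP <-.
rewrite -sum1_card [X in _ <= X]big_mkcond [X in X <= _]big_mkcond /=.
by apply: leq_sum => x _; case: ifP => // _; case: ifP.
Qed.

Definition inner_pairs S : {set {set T}} := [set e in pairs T | e \subset S].

Definition touching_pairs S : {set {set T}} := [set e in pairs T | ~~ [disjoint e & S]].

Lemma card_inner_pairs S : #|inner_pairs S| = 'C(#|S|, 2).
Proof.
by rewrite -cards_draws; apply: eq_card => e; rewrite !inE andbC.
Qed.

Lemma pair_in_pairs (x y : T) : x != y -> [set x; y] \in pairs T.
Proof. by rewrite inE cards2 => ->. Qed.

Lemma inner_pairsP S x y : x \in S -> y \in S -> x != y ->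
  [set x; y] \in inner_pairs S.
Proof.
by move=> xS yS xy; rewrite inE pair_in_pairs // subUset !sub1set xS yS.
Qed.

Lemma touching_pairsP S x y : x \in S -> x != y -> [set x; y] \in touching_pairs S.
Proof.
move=> xS xy; rewrite inE pair_in_pairs //=; apply/pred0Pn; exists x.
by rewrite /= xS !inE eqxx.
Qed.

Lemma card_touching_pairs S : #|touching_pairs S| <= #|S| * #|T|.
Proof.
rewrite -[#|T|]cardsT -cardsX.
apply: leq_trans (leq_imset_card (fun u : T * T => [set u.1; u.2]) _).
apply: subset_leq_card; apply/subsetP => e; rewrite !inE.
case/andP=> /cards2P[x [y [xy ->]]] /pred0Pn[z /andP[/= zxy zS]].
move: zxy; rewrite !inE => /orP[] /eqP zE; apply/imsetP.
  by exists (x, y); rewrite //= !inE -zE zS.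
by exists (y, x); rewrite /= 1?setUC // !inE -zE zS.
Qed.

(** The degree sum is at most twice the number of edges, so [S] spans at least [6 * #|S| / 5] of
    them; the second summand is [#|S| / 5] rounded up. *)
Lemma not_locally_sparse G M : ~~ locally_sparse (adj G) M ->
  exists S, [/\ 0 < #|S|, #|S| <= M &
    #|S| + (#|S| + 4) %/ 5 <= #|inner_pairs S :&: edges G|].
Proof.
case/forallPn => S; rewrite negb_imply -leqNgt => /andP[/andP[S0 SM] dS].
exists S; split=> //; first by rewrite card_gt0.
have := @degsum_adj_le G (inner_pairs S) S S
    (fun x y xS yS xy => inner_pairsP xS yS (adj_neq xy)).
by move: dS; clear; lia.
Qed.

Lemma many_high_degree G D m : m <= #|high_degree (adj G) (2 * D)| ->
  exists S, #|S| = m /\ m * D <= #|touching_pairs S :&: edges G|.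
Proof.
case/exists_subset_card => S SH cS; exists S; split=> //.
have := @degsum_adj_le G (touching_pairs S) S setT
  (fun x y xS _ xy => touching_pairsP xS (adj_neq xy)).
have : m * (2 * D) <= degsum (adj G) S setT.
  rewrite -cS -sum_nat_const; apply: leq_sum => x /(subsetP SH).
  by rewrite inE => /ltnW.
lia.
Qed.

End EdgeCounts.

(** * Colourings that depend only on blocks *)

Definition pair_colour (T B : finType) (phi : T -> B) (chi : rel B) (e : {set T}) : bool :=
  [exists x, exists y, [&& x \in e, y \in e, x != y & chi (phi x) (phi y)]].

Section BlockColouring.
Variables (B : finType) (chi : rel B).
Hypothesis chi_sym : symmetric chi.

Lemma pair_colour2 (T : finType) (phi : T -> B) x y : x != y ->
  pair_colour phi chi [set x; y] = chi (phi x) (phi y).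
Proof.
move=> xy; apply/existsP/idP => [[x' /existsP[y' /and4P[]]]|c]; last first.
  by exists x; apply/existsP; exists y; rewrite set21 set22 xy.
rewrite !in_set2 => /orP[] /eqP -> /orP[] /eqP ->; rewrite ?eqxx //.
by rewrite chi_sym.
Qed.

(** The colours on the copy depend only on the composed map [blk \o f] into the blocks. A union
    bound can therefore run over maps to [B], which are far fewer than the injections into
    ['I_N]. *)
Lemma ramsey_good_block (T : finType) (G : sgraph T) N (blk : 'I_N -> B) :
  ramsey_good G N -> exists (f : T -> 'I_N) (b : bool), injective f /\
    forall e, e \in edges G -> pair_colour (blk \o f) chi e = b.
Proof.
case/andP=> _ /forallP/(_ [ffun e => pair_colour blk chi e]).
case/existsP=> f /existsP[b /andP[/injectiveP fi /forall_inP H]].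
exists f, b; split=> // e eG; have := H e eG; rewrite ffunE => /eqP <-.
have [u [v [uv -> _]]] := edgeP eG.
by rewrite imset_set2 !pair_colour2 // (inj_eq fi).
Qed.

Definition off_colour (T : finType) (phi : T -> B) (b : bool) : {set {set T}} :=
  [set e in pairs T | pair_colour phi chi e != b].

(** The diagonal accounts for [#|T|] ordered pairs, and every two-element set for two. *)
Lemma card_off_colour (T : finType) (phi : T -> B) b :
  #|[set u : T * T | chi (phi u.1) (phi u.2) != b]| <= #|T| + 2 * #|off_colour phi b|.
Proof.
have sF : off_colour phi b \subset pairs T.
  by apply/subsetP => e; rewrite inE => /andP[].
pose G := SGraph sF.
have dG : degsum (adj G) setT setT <= 2 * #|off_colour phi b|.
  by have := @degsum_adj_le T G (off_colour phi b) setT setT; rewrite setIid; apply.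
apply: leq_trans (_ : _ <= #|[set u : T * T | u.1 == u.2] :|:
    [set u : T * T | adj G u.1 u.2]|) _.
  apply: subset_leq_card; apply/subsetP => -[x y]; rewrite !inE /=.
  by have [//|xy] := eqVneq x y; rewrite /adj /= inE pair_in_pairs // pair_colour2.
have [+ _] := leq_card_setU [set u : T * T | u.1 == u.2] [set u : T * T | adj G u.1 u.2].
move=> /leq_trans; apply; apply: leq_add.
  rewrite -cardsT; apply: leq_trans (leq_imset_card (fun x => (x, x)) _).
  apply: subset_leq_card; apply/subsetP => -[x y]; rewrite inE /= => /eqP ->.
  by apply/imsetP; exists y.
apply: leq_trans dG; rewrite /degsum -sum1_card big_mkcond.
rewrite [X in _ <= X](eq_bigr (fun x => \sum_y adj G x y)) => [|x _]; last first.
  by rewrite card_nbrE; apply: eq_bigl => y; rewrite inE.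
rewrite [X in _ <= X](eq_bigl xpredT) => [|x]; last by rewrite inE.
rewrite pair_bigA /=; apply: leq_sum => u _; rewrite inE.
by case: (adj G u.1 u.2).
Qed.

End BlockColouring.

Lemma exists_balanced_blocks (B : finType) N s : 0 < s -> N <= #|B| * s ->
  exists blk : 'I_N -> B, forall a, #|[set i | blk i == a]| <= s.
Proof.
move=> s0 Ns.
have lt (i : 'I_N) : i %/ s < #|B| by rewrite ltn_divLR // (leq_trans (ltn_ord i)).
exists (fun i => enum_val (Ordinal (lt i))) => a.
pose g (i : 'I_N) : 'I_s := Ordinal (ltn_pmod i s0).
rewrite -[X in _ <= X]card_ord -(card_in_imset (f := g)) ?max_card //.
move=> i j; rewrite !inE => /eqP <- /eqP /enum_val_inj /(congr1 val) /= eq1.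
move=> /(congr1 val) /= eq2; apply: val_inj => /=.
by rewrite (divn_eq i s) (divn_eq j s) eq1 eq2.
Qed.

Local Open Scope ring_scope.

(** * First-moment tools for the random graph *)

Section RandomGraph.
Variables (R : realType) (n : nat) (p : R).
Implicit Types (E : pred (sgraph 'I_n)) (F : {set {set 'I_n}}) (G : sgraph 'I_n).

(** Expanding the product yields one term per edge set. Setting [a] or [b] to 0 on chosen pairs then
    gives the probabilities of containing or avoiding them. *)
Lemma sum_sgraph (a b : {set 'I_n} -> R) :
  \sum_(G : sgraph 'I_n) \prod_(e in pairs 'I_n) (if e \in edges G then a e else b e)
  = \prod_(e in pairs 'I_n) (a e + b e).
Proof.
rewrite [RHS]big_mkcond /=.
(* The product is extended to all subsets of the vertex set; the value 0 kills the terms with a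
   non-pair as an edge. *)
pose a' e := if e \in pairs 'I_n then a e else 0.
pose b' e := if e \in pairs 'I_n then b e else 1.
rewrite (eq_bigr (fun e => a' e + b' e)); last first.
  by move=> e _; rewrite /a' /b'; case: ifP => // _; rewrite add0r.
rewrite bigA_distr (bigID (fun J : {set {set 'I_n}} => J \subset pairs 'I_n)) /=.
rewrite [X in _ = _ + X]big1 ?addr0; last first.
  move=> J /subsetPn[e eJ eN]; rewrite (bigD1 e) //= eJ /a' (negPf eN).
  by rewrite mul0r.
rewrite (reindex_omap (@edges _) insub) /=; last first.
  by move=> J sJ; rewrite insubT.
apply: eq_big => [G|G _].
  by rewrite edges_pairs (valK G) eqxx.
rewrite [LHS]big_mkcond; apply: eq_bigr => e _; rewrite /a' /b'.
case: ifP => // eN; case: ifP => // eG.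
by rewrite (subsetP (edges_pairs G)) in eN.
Qed.

Definition weight G : R :=
  \prod_(e in pairs 'I_n) (if e \in edges G then p else 1 - p).

Lemma Gnp_probE E : Gnp_prob n p E = \sum_(G | E G) weight G.
Proof. by []. Qed.

Lemma Gnp_prob_contains F : F \subset pairs 'I_n ->
  Gnp_prob n p (fun G => F \subset edges G) = p ^+ #|F|.
Proof.
move=> sF; rewrite Gnp_probE big_mkcond /=.
rewrite (eq_bigr (fun G => \prod_(e in pairs 'I_n)
   (if e \in edges G then p else if e \in F then 0 else 1 - p))); last first.
  move=> G _; case: ifP => [FG|/negbT/subsetPn[e eF eN]].
    apply: eq_bigr => e _; case: ifP => // eN; case: ifP => // eF.
    by rewrite (subsetP FG) in eN.
  by rewrite (bigD1 e) ?(subsetP sF) //= (negPf eN) eF mul0r.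
rewrite sum_sgraph (bigID (mem F)) /= [X in _ * X]big1 ?mulr1; last first.
  by move=> e /andP[_ /negPf ->]; rewrite addrC subrK.
rewrite -prodr_const; apply: eq_big => e.
  by rewrite andbC; case eF: (e \in F) => //=; rewrite (subsetP sF).
by move=> /andP[_ ->]; rewrite addr0.
Qed.

Lemma Gnp_prob_avoids F : F \subset pairs 'I_n ->
  Gnp_prob n p (fun G => [disjoint F & edges G]) = (1 - p) ^+ #|F|.
Proof.
move=> sF; rewrite Gnp_probE big_mkcond /=.
rewrite (eq_bigr (fun G => \prod_(e in pairs 'I_n)
   (if e \in edges G then if e \in F then 0 else p else 1 - p))); last first.
  move=> G _; case: ifP => [FG|/negbT/pred0Pn[e /andP[/= eF eG]]].
    apply: eq_bigr => e _; case: ifP => // eG; case: ifP => // eF.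
    by rewrite (disjointFr FG) in eG.
  by rewrite (bigD1 e) ?(subsetP sF) //= eG eF mul0r.
rewrite sum_sgraph (bigID (mem F)) /= [X in _ * X]big1 ?mulr1; last first.
  by move=> e /andP[_ /negPf ->]; rewrite addrC subrK.
rewrite -prodr_const; apply: eq_big => e.
  by rewrite andbC; case eF: (e \in F) => //=; rewrite (subsetP sF).
by move=> /andP[_ ->]; rewrite add0r.
Qed.

Lemma Gnp_probC E : Gnp_prob n p E + Gnp_prob n p (fun G => ~~ E G) = 1.
Proof.
have := Gnp_prob_contains (sub0set _).
rewrite cards0 expr0 Gnp_probE => <-.
rewrite (bigID E) /=; congr (_ + _); apply: eq_bigl => G.
  by rewrite sub0set.
by rewrite sub0set.
Qed.

Hypothesis p01 : 0 <= p <= 1.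

Lemma weight_ge0 G : 0 <= weight G.
Proof.
case/andP: p01 => p0 p1.
by apply: prodr_ge0 => e _; case: ifP => // _; rewrite subr_ge0.
Qed.

Lemma Gnp_prob_ge0 E : 0 <= Gnp_prob n p E.
Proof. by apply: sumr_ge0 => G _; apply: weight_ge0. Qed.

(** Markov's inequality for the number of events that occur. With [c = 1] it is the union bound;
    larger [c] serves for isolated vertices, where one bad graph has many witnesses. *)
Lemma Gnp_prob_markov (I : finType) (A : {set I}) (E : pred (sgraph 'I_n))
    (Ei : I -> pred (sgraph 'I_n)) (c : nat) :
  (forall G, E G -> (c <= #|[set i in A | Ei i G]|)%N) ->
  c%:R * Gnp_prob n p E <= \sum_(i in A) Gnp_prob n p (Ei i).
Proof.
move=> H; under [X in _ <= X]eq_bigr do rewrite Gnp_probE big_mkcond.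
rewrite exchange_big /= Gnp_probE mulr_sumr [X in X <= _]big_mkcond /=.
apply: ler_sum => G _.
have -> : \sum_(i in A) (if Ei i G then weight G else 0) =
    #|[set i in A | Ei i G]|%:R * weight G.
  rewrite -big_mkcondr /= mulr_natl -sumr_const; apply: eq_bigl => i.
  by rewrite inE.
case: ifP => [/H EG|_]; first by rewrite ler_wpM2r ?weight_ge0 // ler_nat.
by rewrite mulr_ge0 ?weight_ge0.
Qed.

Lemma Gnp_prob_union (I : finType) (A : {set I}) (E : pred (sgraph 'I_n))
    (Ei : I -> pred (sgraph 'I_n)) :
  (forall G, E G -> exists2 i, i \in A & Ei i G) ->
  Gnp_prob n p E <= \sum_(i in A) Gnp_prob n p (Ei i).
Proof.
move=> H; rewrite -[X in X <= _]mul1r; apply: (@Gnp_prob_markov _ _ _ _ 1) => G.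
by move=> /H[i iA Ei']; apply/card_gt0P; exists i; rewrite inE iA.
Qed.

Lemma Gnp_prob_sub E1 E2 : (forall G, E1 G -> E2 G) ->
  Gnp_prob n p E1 <= Gnp_prob n p E2.
Proof.
move=> H; have := @Gnp_prob_union _ [set tt] E1 (fun=> E2).
by rewrite big_set1; apply=> G /H; exists tt; rewrite ?inE.
Qed.

Lemma Gnp_prob_many_edges (A : {set {set 'I_n}}) f : A \subset pairs 'I_n ->
  Gnp_prob n p (fun G => (f <= #|A :&: edges G|)%N) <= 'C(#|A|, f)%:R * p ^+ f.
Proof.
move=> sA; pose FF := [set F : {set {set 'I_n}} | F \subset A & #|F| == f].
apply: le_trans (_ : _ <= \sum_(F in FF) Gnp_prob n p (fun G => F \subset edges G)) _.
  apply: Gnp_prob_union => G /exists_subset_card[F FA cF]; exists F.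
    by rewrite inE cF eqxx andbT (subset_trans FA (subsetIl _ _)).
  exact: subset_trans FA (subsetIr _ _).
rewrite (eq_bigr (fun=> p ^+ f)); last first.
  move=> F; rewrite inE => /andP[FA /eqP <-]; apply: Gnp_prob_contains.
  exact: subset_trans FA sA.
by rewrite sumr_const cards_draws mulr_natl.
Qed.

End RandomGraph.

(** * Sets that span or touch too many edges *)

Section RareEvents.
Variables (R : realType) (n : nat) (p : R) (D : nat).
Hypotheses (p01 : 0 <= p <= 1) (pD : p * n%:R <= D%:R).

Lemma Gnp_prob_dense_sets (A : {set 'I_n} -> {set {set 'I_n}}) j f a :
  (forall S : {set 'I_n}, A S \subset pairs 'I_n) -> (forall S : {set 'I_n}, #|S| = j -> (#|A S| <= a)%N) ->
  Gnp_prob n p (fun G => [exists S : {set 'I_n},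
    (#|S| == j) && (f <= #|A S :&: edges G|)%N]) <= 'C(n, j)%:R * ('C(a, f)%:R * p ^+ f).
Proof.
move=> Ap Aa; case/andP: (p01) => p0 _.
pose FF := [set S : {set 'I_n} | #|S| == j].
apply: le_trans (_ : _ <= \sum_(S in FF)
    Gnp_prob n p (fun G => (f <= #|A S :&: edges G|)%N)) _.
  apply: Gnp_prob_union => // G /existsP[S /andP[cS fS]].
  by exists S; rewrite // inE.
have <- : #|FF| = 'C(n, j) by rewrite card_draws card_ord.
rewrite mulr_natl -sumr_const; apply: ler_sum => S; rewrite inE => /eqP cS.
apply: le_trans (Gnp_prob_many_edges p01 f (Ap S)) _.
by rewrite ler_wpM2r ?exprn_ge0 // ler_nat leq_bin2l // Aa.
Qed.

(** With [i] equal to [j / 5] rounded up and [f = j + i], the factors are at most [(4 * n / j) ^ j],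
    [(2 * j) ^ f] and [(D / n) ^ f], with product [(8 * D) ^ j * (2 * j * D / n) ^ i]. Since
    [j <= 5 * i], this is at most [(A * j / n) ^ i], which explains the choice of [A]. *)
Lemma dense_term (j : nat) (A := ((8 * D) ^ 5 * (2 * D))%N) : (0 < j)%N -> (0 < n)%N ->
  (0 < D)%N -> (4 * A * j <= n)%N ->
  'C(n, j)%:R * ('C('C(j, 2), j + (j + 4) %/ 5)%:R * p ^+ (j + (j + 4) %/ 5))
  <= 5%:R * A%:R / n%:R * 2%:R^-1 ^+ (j.-1 %/ 5) :> R.
Proof.
move=> j0 n0 D0 jn; case/andP: (p01) => p0 _.
set i := ((j + 4) %/ 5)%N; set f := (j + i)%N.
have f0 : (0 < f)%N by rewrite addn_gt0 j0.
have j5 : (j <= 5 * i)%N by rewrite /i; clear -j0; lia.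
have n0' : 0 < n%:R :> R by rewrite ltr0n.
have j0' : 0 < j%:R :> R by rewrite ltr0n.
have pf : p ^+ f <= (D%:R / n%:R) ^+ f.
  by apply: lerXn2r; rewrite ?nnegrE ?divr_ge0 ?ler0n // ler_pdivlMr.
pose x : R := (A * j)%:R / n%:R.
have x0 : 0 <= x by rewrite divr_ge0 ?ler0n.
have x4 : x <= 2%:R^-1 ^+ 2.
  rewrite ler_pdivrMr // -ler_pdivrMl ?exprn_gt0 ?invr_gt0 //.
  rewrite -exprVn invrK -natrX -natrM ler_nat.
  by apply: leq_trans jn; rewrite mulnA.
have b1 : 'C(n, j)%:R <= (4%:R * n%:R / j%:R) ^+ j :> R.
  rewrite expr_div_n ler_pdivlMr ?exprn_gt0 //.
  by rewrite -natrM -!natrX -natrM ler_nat bin_mul_expnn_le.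
have b2 : 'C('C(j, 2), f)%:R <= (2%:R * j%:R) ^+ f :> R.
  rewrite -natrM -natrX ler_nat.
  have jf0 : (0 < j ^ f)%N by rewrite expn_gt0 j0.
  rewrite -(leq_pmul2r jf0) -expnMn.
  apply: leq_trans (_ : 'C('C(j, 2), f) * f ^ f <= _)%N.
    by rewrite leq_mul2l leq_exp2r ?leq_addr ?orbT.
  apply: leq_trans (bin_mul_expnn_le _ _) _; rewrite leq_exp2r //.
  have -> : (4 * 'C(j, 2) = 2 * ('C(j, 2) * 2`!))%N by rewrite (_ : 2`! = 2)%N //; clear; lia.
  by rewrite bin_ffact ffactnS ffactn1 -mulnA !leq_mul // leq_pred.
pose y : R := 2%:R * j%:R * (D%:R / n%:R).
have y0 : 0 <= y by rewrite !mulr_ge0 ?invr_ge0 ?ler0n.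
have b3 : 'C('C(j, 2), f)%:R * p ^+ f <= y ^+ f.
  by rewrite exprMn ler_pM // exprn_ge0.
apply: le_trans (ler_pM _ _ b1 b3) _; rewrite ?mulr_ge0 ?exprn_ge0 ?ler0n //.
have -> : (4%:R * n%:R / j%:R) ^+ j * y ^+ f = (8 * D)%:R ^+ j * y ^+ i.
  rewrite /f exprD mulrA -exprMn; congr (_ ^+ _ * _).
  by rewrite /y natrM; field; rewrite !gt_eqF.
have b4 : (8 * D)%:R ^+ j * y ^+ i <= x ^+ i.
  have -> : x = (8 * D)%:R ^+ 5 * y.
    rewrite /x /A -mulnA natrM natrX -mulrA; congr (_ * _).
    by rewrite /y !natrM; field; rewrite gt_eqF.
  rewrite [X in _ <= X]exprMn -exprM ler_wpM2r ?exprn_ge0 //.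
  by apply: ler_weXn2l j5; rewrite ler1n muln_gt0.
apply: le_trans b4 _.
have iE : i = (j.-1 %/ 5).+1 by rewrite /i; clear -j0; lia.
rewrite iE; set i' := (_ %/ 5)%N in iE *.
(* Since [x <= 1 / 4], there are two factors [1 / 2 ^ i']: one stays for the geometric series, the
   other absorbs [j <= 5 * (i' + 1)]. *)
rewrite exprS; apply: le_trans (_ : x * (2%:R^-1 ^+ 2) ^+ i' <= _).
  by rewrite ler_wpM2l // lerXn2r // nnegrE exprn_ge0 // invr_ge0.
rewrite -exprM mulnC exprM expr2 mulrA ler_wpM2r ?exprn_ge0 ?invr_ge0 //.
rewrite /x exprVn ler_pdivrMr ?exprn_gt0 // mulrAC ler_pM2r ?invr_gt0 //.
rewrite -natrX -!natrM ler_nat [(5 * A)%N]mulnC -[(A * 5 * _)%N]mulnA leq_mul2l; apply/orP; right.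
apply: leq_trans j5 _; rewrite leq_mul2l iE /=.
exact: ltn_expl.
Qed.

End RareEvents.

(** * The upper bound with high probability *)

Section UpperBoundProbability.
Variables (R : realType) (n : nat) (p : R) (D : nat).
Hypotheses (p01 : 0 <= p <= 1) (pD : p * n%:R <= D%:R).
Hypotheses (n0 : (0 < n)%N) (D0 : (0 < D)%N).

(** Every power of [1 / 2] occurs at most five times, and the geometric series has sum 2. *)
Lemma sum_half_div5 (m : nat) : \sum_(j < m) 2%:R^-1 ^+ (j %/ 5) <= 10%:R :> R.
Proof.
have h0 k : 0 <= 2%:R^-1 ^+ k :> R by rewrite exprn_ge0 ?invr_ge0.
have sum5 k : \sum_(0 <= j < 5 * k) 2%:R^-1 ^+ (j %/ 5) =
    10%:R - 10%:R * 2%:R^-1 ^+ k :> R.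
  elim: k => [|k IH]; first by rewrite muln0 big_geq // expr0 mulr1 subrr.
  have -> : (5 * k.+1 = (5 * k).+4.+1)%N by lia.
  rewrite !big_nat_recr //= IH.
  have -> : ((5 * k) %/ 5 = k)%N by lia.
  have -> : ((5 * k).+1 %/ 5 = k)%N by lia.
  have -> : ((5 * k).+2 %/ 5 = k)%N by lia.
  have -> : ((5 * k).+3 %/ 5 = k)%N by lia.
  have -> : ((5 * k).+4 %/ 5 = k)%N by lia.
  by rewrite exprS; field.
rewrite -(big_mkord xpredT (fun j => 2%:R^-1 ^+ (j %/ 5))).
apply: (@le_trans _ _ (\sum_(0 <= j < 5 * m) 2%:R^-1 ^+ (j %/ 5))).
  rewrite [X in _ <= X](big_cat_nat (n := m)) //=; last by lia.
  by rewrite lerDl sumr_ge0.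
by rewrite sum5 gerBl mulr_ge0.
Qed.

Let A := ((8 * D) ^ 5 * (2 * D))%N.

Let A0 : (0 < A)%N.
Proof. by rewrite muln_gt0 expn_gt0 !muln_gt0 D0. Qed.

Lemma Gnp_prob_not_locally_sparse M : (4 * A * M <= n)%N ->
  Gnp_prob n p (fun G => ~~ locally_sparse (adj G) M) <= 50%:R * A%:R / n%:R.
Proof.
move=> Mn; pose f j := (j + (j + 4) %/ 5)%N.
apply: le_trans (_ : _ <= \sum_(j in [set: 'I_M]) Gnp_prob n p (fun G =>
    [exists S : {set 'I_n}, (#|S| == j.+1) && (f j.+1 <= #|inner_pairs S :&: edges G|)%N])) _.
  apply: Gnp_prob_union => // G /not_locally_sparse[S [S0 SM dS]].
  have Sj : (#|S|.-1 < M)%N by rewrite prednK.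
  by exists (Ordinal Sj); rewrite ?inE //; apply/existsP; exists S; rewrite /= prednK // eqxx.
apply: le_trans (_ : _ <= \sum_(j < M) (5%:R * A%:R / n%:R * 2%:R^-1 ^+ (j %/ 5))) _.
  rewrite (eq_bigl xpredT); last by move=> j; rewrite inE.
  apply: ler_sum => j _.
  apply: le_trans (@Gnp_prob_dense_sets _ _ _ p01 _ j.+1 (f j.+1) 'C(j.+1, 2) _ _) _.
  - by move=> S; apply/subsetP => e; rewrite inE => /andP[].
  - by move=> S cS; rewrite card_inner_pairs cS.
  apply: dense_term => //; apply: leq_trans Mn.
  by rewrite leq_mul2l ltn_ord orbT.
rewrite -mulr_sumr.
apply: le_trans (ler_wpM2l _ (sum_half_div5 M)) _.
  by rewrite divr_ge0 ?mulr_ge0.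
by rewrite le_eqVlt; apply/orP; left; apply/eqP; field; rewrite gt_eqF ?ltr0n.
Qed.

(** The choice of an [m]-set costs [(4 * C) ^ m], and [m * K] edges touching it have probability at
    most [(4 * D / K) ^ (m * K)]. As [8 * D <= K] and [8 * C <= 2 ^ K], a factor [1 / 2] per vertex
    remains. *)
Lemma Gnp_prob_many_high_degree m C K : (0 < m)%N -> (n <= C * m)%N ->
  (8 * C <= 2 ^ K)%N -> (8 * D <= K)%N ->
  Gnp_prob n p (fun G => (m <= #|high_degree (adj G) (2 * K)|)%N) <= 2%:R^-1 ^+ m.
Proof.
move=> m0 nC CK DK; set f := (m * K)%N.
have K0 : (0 < K)%N by apply: leq_trans DK; rewrite muln_gt0.
have f0 : (0 < f)%N by rewrite muln_gt0 m0.
case/andP: (p01) => p0 _.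
have n0' : 0 < n%:R :> R by rewrite ltr0n.
have m0' : 0 < m%:R :> R by rewrite ltr0n.
have K0' : 0 < K%:R :> R by rewrite ltr0n.
apply: le_trans (_ : _ <= Gnp_prob n p (fun G => [exists S : {set 'I_n},
    (#|S| == m) && (f <= #|touching_pairs S :&: edges G|)%N])) _.
  apply: Gnp_prob_sub => // G /many_high_degree[S [cS fS]].
  by apply/existsP; exists S; rewrite cS eqxx.
apply: le_trans (@Gnp_prob_dense_sets _ _ _ p01 _ m f (m * n) _ _) _.
- by move=> S; apply/subsetP => e; rewrite inE => /andP[].
- by move=> S cS; apply: leq_trans (card_touching_pairs S) _; rewrite cS card_ord.
have b1 : 'C(n, m)%:R <= (4%:R * C%:R) ^+ m :> R.
  rewrite -natrM -natrX ler_nat.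
  have mm0 : (0 < m ^ m)%N by rewrite expn_gt0 m0.
  rewrite -(leq_pmul2r mm0); apply: leq_trans (bin_mul_expnn_le n m) _.
  by rewrite -expnMn leq_exp2r // -mulnA leq_mul2l.
have b2 : 'C(m * n, f)%:R * p ^+ f <= 2%:R^-1 ^+ f :> R.
  apply: le_trans (_ : (4%:R * n%:R / K%:R) ^+ f * (D%:R / n%:R) ^+ f <= _).
    apply: ler_pM; rewrite ?ler0n ?exprn_ge0 //; last first.
      by rewrite lerXn2r ?nnegrE ?divr_ge0 // ler_pdivlMr.
    rewrite expr_div_n ler_pdivlMr ?exprn_gt0 // -natrM -!natrX -natrM ler_nat.
    have mf0 : (0 < m ^ f)%N by rewrite expn_gt0 m0.
    rewrite -(leq_pmul2r mf0) -mulnA -expnMn [(K * m)%N]mulnC -/f.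
    apply: leq_trans (bin_mul_expnn_le _ _) _.
    by rewrite -expnMn leq_exp2r //; lia.
  rewrite -exprMn lerXn2r ?nnegrE ?invr_ge0 ?mulr_ge0 ?invr_ge0 //.
  have -> : 4%:R * n%:R / K%:R * (D%:R / n%:R) = 4%:R * D%:R / K%:R :> R.
    by field; rewrite !gt_eqF.
  rewrite ler_pdivrMr // -ler_pdivrMl ?invr_gt0 // invrK -!natrM ler_nat.
  by apply: leq_trans DK; rewrite mulnA.
apply: le_trans (ler_pM _ _ b1 b2) _; rewrite ?mulr_ge0 ?exprn_ge0 ?ler0n //.
rewrite /f mulnC exprM -exprMn lerXn2r ?nnegrE ?mulr_ge0 ?exprn_ge0 ?invr_ge0 //.
rewrite exprVn ler_pdivrMr ?exprn_gt0 // -ler_pdivrMl ?invr_gt0 // invrK.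
by rewrite -natrX -!natrM ler_nat mulnA.
Qed.

Lemma Gnp_prob_ramsey_large h : (4 * A <= n)%N -> (32 * (64 * D) <= 2 ^ h)%N ->
  Gnp_prob n p (fun G => ~~ (ramsey G <=
     4 * n * (16 * (64 * D) * (128 * (64 * D)) ^ (64 * D)) ^ h)%N)
  <= 66%:R * A%:R / n%:R.
Proof.
(* [M] is the largest scale at which the local sparsity estimate applies. Fewer than [m] high-degree
   vertices means at most [M / 4] of them, as the core requires. *)
move=> An Dh; set M := (n %/ (4 * A))%N; set m := (M %/ 4).+1.
have A40 : (0 < 4 * A)%N by rewrite muln_gt0.
have M0 : (0 < M)%N by rewrite divn_gt0.
have Mn : (4 * A * M <= n)%N by rewrite mulnC leq_divM.
have nm : (n <= 16 * A * m)%N.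
  apply: ltnW; apply: leq_trans (ltn_ceil n A40) _; rewrite -/M.
  have : (M.+1 <= 4 * m)%N by rewrite /m; clear; lia.
  by move=> /(leq_mul (leqnn (4 * A))); rewrite mulnC => /leq_trans; apply; clear; lia.
have n0' : 0 < n%:R :> R by rewrite ltr0n.
apply: le_trans (_ : _ <= \sum_(b in [set: bool]) Gnp_prob n p (fun G =>
    if b then ~~ locally_sparse (adj G) M
    else (m <= #|high_degree (adj G) (2 * (32 * D))|)%N)) _.
  apply: Gnp_prob_union => // G rN.
  have [sp|sp] := boolP (locally_sparse (adj G) M); last by exists true; rewrite ?inE.
  have [hi|lo] := leqP m #|high_degree (adj G) (2 * (32 * D))|.
    by exists false; rewrite ?inE.
  case/negP: rN; have := @ramsey_upper 'I_n G M (64 * D) h; rewrite card_ord; apply => //.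
    by move: lo; rewrite mulnA -[(2 * 32)%N]/(64)%N /m; clear; lia.
  by move: D0; clear; lia.
rewrite (eq_bigl xpredT) ?big_bool /=; last by move=> b; rewrite inE.
have -> : 66%:R * A%:R / n%:R = 50%:R * A%:R / n%:R + 16%:R * A%:R / n%:R :> R.
  by field; rewrite gt_eqF.
apply: lerD; first exact: Gnp_prob_not_locally_sparse.
apply: le_trans (@Gnp_prob_many_high_degree m (16 * A) (32 * D) _ nm _ _) _ => //.
(* For [C = 16 * A] and [K = 32 * D] the condition [8 * C <= 2 ^ K] reads
   [2 ^ 23 * D ^ 6 <= 2 ^ (32 * D)]. *)
- have : (D ^ 6 <= 2 ^ (6 * D))%N.
    by rewrite mulnC expnM leq_exp2r // ltnW // ltn_expl.
  have -> : (8 * (16 * A) = 2 ^ 23 * D ^ 6)%N.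
    transitivity (2 ^ 3 * (2 ^ 4 * ((2 ^ 3 * D) ^ 5 * (2 ^ 1 * D))))%N; first by [].
    rewrite expnMn -expnM (expnSr D 5) -[23%N]/(3 + 4 + 3 * 5 + 1)%N !expnD.
    by move: (2 ^ 3)%N (2 ^ 4)%N (2 ^ 1)%N (2 ^ (3 * 5))%N (D ^ 5)%N; clear; nia.
  move=> le1; apply: leq_trans (leq_mul (leqnn _) le1) _.
  by rewrite -expnD leq_exp2l //; move: D0; clear; lia.
- by rewrite leq_mul2r orbT.
rewrite exprVn ler_pdivlMr // ler_pdivrMl ?exprn_gt0 //.
rewrite -natrX -!natrM ler_nat mulnC; apply: leq_trans nm _.
by rewrite leq_mul2l ltnW ?orbT // ltn_expl.
Qed.

End UpperBoundProbability.

(** * The Hadamard colouring and Lindsey's lemma *)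

Section Hadamard.
Variable m : nat.
Implicit Types (a b c : {set 'I_m}).

(** The associated signs form Sylvester's Hadamard matrix of order [2 ^ m]. *)
Definition odd_meet : rel {set 'I_m} := fun a b => odd #|a :&: b|.

Lemma odd_meet_sym : symmetric odd_meet.
Proof. by move=> a b; rewrite /odd_meet setIC. Qed.

Let sgn a b : int := (-1) ^+ odd_meet a b.

Lemma sgn_prod a b :
  sgn a b = \prod_i (if i \in a then (-1) ^+ (i \in b : nat) else 1).
Proof.
rewrite -big_mkcond /= prodrXr /sgn /odd_meet signr_odd; congr (_ ^+ _).
rewrite -sum1_card big_mkcond [RHS]big_mkcond /=; apply: eq_bigr => i _.
by rewrite inE; case: (i \in a); case: (i \in b).
Qed.

(** The sum factors over the coordinates, and a coordinate on which [b] and [c] differ contributes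
    the factor 0. *)
Lemma sgn_orthogonal b c :
  \sum_a sgn a b * sgn a c = if b == c then 2 ^+ m else 0.
Proof.
pose F (i : 'I_m) : int := (-1) ^+ (i \in b : nat) * (-1) ^+ (i \in c : nat).
transitivity (\prod_i (F i + 1)).
  rewrite bigA_distr; apply: eq_big => [a|a _]; first by rewrite inE.
  rewrite !sgn_prod -big_split /=; apply: eq_bigr => i _.
  by case: ifP => // _; rewrite mulr1.
rewrite /F; case: eqP => [->|/eqP bc].
  rewrite (eq_bigr (fun=> 2)) ?prodr_const ?card_ord // => i _.
  by rewrite -expr2 sqrr_sign.
have [i ibc] : exists i, (i \in b) != (i \in c).
  apply/existsP; apply: contraR bc => /existsPn H; apply/eqP/setP => i.
  by have := H i; rewrite negbK => /eqP.
rewrite (bigD1 i) //=; move: ibc.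
by case: (i \in b); case: (i \in c); rewrite ?expr0 ?expr1 ?mulr1 ?mul1r ?addNr ?mul0r.
Qed.

Variables (T : finType) (phi : T -> {set 'I_m}) (s : nat).
Hypothesis fibre_le : forall a, (#|[set u | phi u == a]| <= s)%N.
Let n := #|T|.
Hypothesis s_le : (4 * s ^ 2 * 2 ^ m <= n ^ 2)%N.

Let y a : int := \sum_v sgn a (phi v).

(** Summed over all rows [a], orthogonality keeps only pairs of vertices in the same block, at most
    [n * s] of them. Each row is then taken by at most [s] vertices. *)
Lemma sum_sq_le : \sum_u y (phi u) ^+ 2 <= (n * (s ^ 2 * 2 ^ m))%N%:Z.
Proof.
have y2 : \sum_a y a ^+ 2 <= (n * s * 2 ^ m)%N%:Z.
  have -> : \sum_a y a ^+ 2 = \sum_v \sum_w \sum_a sgn a (phi v) * sgn a (phi w).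
    under eq_bigr do rewrite expr2 /y mulr_suml.
    rewrite exchange_big; apply: eq_bigr => v _ /=.
    under eq_bigr do rewrite mulr_sumr.
    by rewrite exchange_big.
  apply: le_trans (_ : _ <= \sum_(v : T) (s * 2 ^ m)%N%:Z) _; last first.
    by rewrite sumr_const -/n -mulr_natl natz -PoszM lez_nat mulnA.
  apply: ler_sum => v _.
  rewrite (eq_bigr (fun w => if phi w == phi v then 2 ^+ m else 0)) => [|w _]; last first.
    by rewrite sgn_orthogonal eq_sym.
  have -> : (s * 2 ^ m)%N%:Z = 2 ^+ m *+ s.
    by rewrite -[RHS]mulr_natl natz PoszM -(natz (2 ^ m)%N) natrX.
  rewrite -big_mkcond sumr_const ler_wpMn2l ?exprn_ge0 //.
  by apply: leq_trans (fibre_le (phi v)); rewrite cardsE.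
apply: le_trans (_ : _ <= s%:Z * \sum_a y a ^+ 2) _.
  rewrite (partition_big phi xpredT) //= mulr_sumr; apply: ler_sum => a _.
  rewrite (eq_bigr (fun=> y a ^+ 2)); last by move=> u /eqP ->.
  rewrite sumr_const -mulr_natl ler_wpM2r ?sqr_ge0 // natz lez_nat.
  by apply: leq_trans (fibre_le a); apply: subset_leq_card; apply/subsetP => u; rewrite !inE.
apply: le_trans (ler_wpM2l _ y2) _; first by [].
by rewrite -PoszM lez_nat; lia.
Qed.

Lemma lindsey_bound (W := \sum_u \sum_v sgn (phi u) (phi v)) :
  2 * `|W| <= (n ^ 2)%N%:Z.
Proof.
have WE : W = \sum_u y (phi u) by [].
have key (t : int) : t ^+ 2 = 1 -> 4 * n%:Z * (t * W) <= 2 * (n ^ 3)%N%:Z.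
  move=> t2; rewrite WE !mulr_sumr.
  (* The square [(2 * t * y - n) ^ 2 >= 0] replaces the Cauchy-Schwarz inequality and keeps the
     computation in the integers; the sign [t] handles both sides of the absolute value. *)
  apply: le_trans (_ : _ <= \sum_u (4 * y (phi u) ^+ 2 + n%:Z ^+ 2)) _.
    apply: ler_sum => u _; rewrite -subr_ge0.
    have -> : 4 * y (phi u) ^+ 2 + n%:Z ^+ 2 - 4 * n%:Z * (t * y (phi u)) =
      (2 * t * y (phi u) - n%:Z) ^+ 2 + 4 * y (phi u) ^+ 2 * (1 - t ^+ 2) by ring.
    by rewrite t2 subrr mulr0 addr0 sqr_ge0.
  rewrite big_split /= sumr_const -mulr_sumr -/n.
  have := sum_sq_le; set Y := \sum_u _ => Yle.
  have : (4 * (n * (s ^ 2 * 2 ^ m)) <= n ^ 3)%N.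
    by rewrite (expnS n 2); apply: leq_trans (leq_mul (leqnn n) s_le); lia.
  have -> : n%:Z ^+ 2 *+ n = (n ^ 3)%N%:Z.
    by rewrite -mulr_natr natz -exprSr -natz -natrX natz.
  rewrite -lez_nat PoszM => le1; apply: le_trans (lerD (ler_wpM2l _ Yle) (lexx _)) _ => //.
  by move: le1; clear; lia.
have [n0|n0] := posnP n.
  by rewrite /W big1 ?normr0 ?mulr0 // => u _; have := card0_eq n0 u; rewrite inE.
have n1 := key 1 (expr1n _ _); have n2 := key (-1) (etrans (sqrrN 1) (expr1n _ 2)).
rewrite expnS PoszM in n1 n2; rewrite mul1r in n1; rewrite mulN1r in n2.
have n0' : 0 < n%:Z by rewrite ltz_nat.
have {}n1 : 2 * W <= (n ^ 2)%N%:Z.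
  by rewrite -(ler_pM2l n0'); move: n1; clear; lia.
have {}n2 : 2 * - W <= (n ^ 2)%N%:Z.
  by rewrite -(ler_pM2l n0'); move: n2; clear; lia.
by move: n1 n2; clear; lia.
Qed.

Lemma odd_meet_balanced (b : bool) :
  (n ^ 2 <= 4 * #|[set u : T * T | odd_meet (phi u.1) (phi u.2) == b]|)%N.
Proof.
have := lindsey_bound; rewrite pair_bigA /=.
set P := [set u : T * T | odd_meet (phi u.1) (phi u.2) == true].
have -> : \sum_(u : T * T) sgn (phi u.1) (phi u.2) = (n ^ 2)%N%:Z - 2 * #|P|%:Z.
  have -> : (n ^ 2)%N%:Z = \sum_(u : T * T) 1.
    by rewrite sumr_const card_prod -mulr_natl mulr1 natz mulnn.
  have -> : #|P|%:Z = \sum_(u : T * T) (if u \in P then 1 else 0).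
    by rewrite -big_mkcond sumr_const natz.
  rewrite mulr_sumr -sumrB; apply: eq_bigr => u _.
  by rewrite /sgn inE; case: (odd_meet _ _).
have : (#|P| + #|~: P| = n ^ 2)%N by rewrite cardsC card_prod mulnn.
have -> : #|[set u : T * T | odd_meet (phi u.1) (phi u.2) == b]| =
    if b then #|P| else #|~: P|.
  case: b => //; apply: eq_card => u; rewrite !inE.
  by case: (odd_meet _ _).
by case: b; clear; lia.
Qed.

End Hadamard.

(** The complete graph on exactly [ramsey G] vertices is cut into blocks of size at most [s].
    Injectivity of the monochromatic copy carries this bound over to the fibres of [phi]. *)
Lemma ramsey_le_hadamard (T : finType) (G : sgraph T) q s : (0 < s)%N ->
  (ramsey G <= 2 ^ q * s)%N -> exists (phi : {ffun T -> {set 'I_q}}) (b : bool),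
    (forall a, (#|[set u | phi u == a]| <= s)%N) /\
    [disjoint off_colour (@odd_meet q) phi b & edges G].
Proof.
move=> s0 rs; have rs' : (ramsey G <= #|{set 'I_q}| * s)%N.
  by rewrite -cardsT -powersetT card_powerset cardsT card_ord.
have [blk blk_le] := exists_balanced_blocks s0 rs'.
have [f [b [fi fc]]] := ramsey_good_block (@odd_meet_sym q) blk (ramsey_goodP G).
exists [ffun u => blk (f u)], b; split=> [a|].
  apply: leq_trans (blk_le a); rewrite -(card_imset _ fi); apply: subset_leq_card.
  by apply/subsetP => i /imsetP[u]; rewrite !inE ffunE => ua ->.
apply/pred0P => e /=; apply/negP => /andP[+ eG].
have [u [v [uv eE _]]] := edgeP eG.
move: (fc e eG); rewrite inE => <- /andP[_].
by rewrite eE !(pair_colour2 (@odd_meet_sym q)) //= !ffunE eqxx.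
Qed.

(** * The union bound over block maps *)

Section LowerBoundProbability.
Variables (R : realType) (n : nat) (p : R).
Hypotheses (p01 : 0 <= p <= 1).

Lemma exprn_1B_le k : (1 - p) ^+ k <= expR (- (p * k%:R)).
Proof.
case/andP: p01 => p0 p1.
rewrite -mulNr expRM_natr lerXn2r ?nnegrE ?subr_ge0 ?expR_ge0 //.
exact: expR_ge1Dx.
Qed.

(** There are [2 * (2 ^ q) ^ n] choices of a colour and a block map. For each, at least [n ^ 2 / 4]
    ordered pairs have the wrong colour; dropping the diagonal and halving gives the exponent. *)
Lemma Gnp_prob_ramsey_le_hadamard q s : (0 < s)%N -> (4 * s ^ 2 * 2 ^ q <= n ^ 2)%N ->
  Gnp_prob n p (fun G => (ramsey G <= 2 ^ q * s)%N) <=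
    2%:R * (2 ^ q)%:R ^+ n * (1 - p) ^+ (n * (n - 4) %/ 8).
Proof.
move=> s0 sn; case/andP: (p01) => p0 p1.
pose A := [set u : {ffun 'I_n -> {set 'I_q}} * bool |
  [forall a, (#|[set x | u.1 x == a]| <= s)%N]].
apply: le_trans (_ : _ <= \sum_(u in A) Gnp_prob n p (fun G =>
   [disjoint off_colour (@odd_meet q) u.1 u.2 & edges G])) _.
  apply: Gnp_prob_union => // G /(ramsey_le_hadamard s0)[phi [b [phis dis]]].
  by exists (phi, b) => //; rewrite inE; apply/forallP.
apply: le_trans (_ : _ <= \sum_(u in A) (1 - p) ^+ (n * (n - 4) %/ 8)) _.
  apply: ler_sum => u; rewrite inE => /forallP us.
  rewrite Gnp_prob_avoids; last by apply/subsetP => e; rewrite inE => /andP[].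
  apply: ler_wiXn2l; rewrite ?subr_ge0 ?gerBl //.
  have := card_off_colour (@odd_meet_sym q) u.1 u.2.
  have := @odd_meet_balanced q _ u.1 s us; rewrite card_ord => /(_ sn (~~ u.2)).
  have -> : [set x | odd_meet (u.1 x.1) (u.1 x.2) == ~~ u.2] =
      [set x | odd_meet (u.1 x.1) (u.1 x.2) != u.2].
    by apply/setP => x; rewrite !inE; case: (odd_meet _ _); case: u.2.
  move: #|_| #|_| => P F; rewrite -mulnn => PF FP.
  rewrite -ltnS ltn_divLR // mulnBr; move: PF FP; clear; lia.
rewrite sumr_const -[leLHS]mulr_natl ler_wpM2r ?exprn_ge0 ?subr_ge0 //.
rewrite -natrX -natrM ler_nat; apply: leq_trans (max_card _) _.
rewrite card_prod card_ffun card_bool card_ord mulnC.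
by rewrite -[#|{set 'I_q}|]cardsT -powersetT card_powerset cardsT card_ord.
Qed.

End LowerBoundProbability.

(** * The two-block colouring for bounded degree *)

Lemma card_ord_interval n (A : {set 'I_n}) lo hi :
  (forall i, i \in A -> lo <= i < hi)%N -> (#|A| <= hi - lo)%N.
Proof.
move=> H; rewrite cardE -(size_map val) -(size_iota lo (hi - lo)).
apply: uniq_leq_size; first by rewrite map_inj_uniq ?enum_uniq //; apply: val_inj.
move=> x /mapP[i]; rewrite mem_enum => /H /andP[li ih] ->.
by rewrite mem_iota li /= subnKC // ltnW // (leq_ltn_trans li ih).
Qed.

Section TwoBlocks.
Variable T : finType.
Implicit Types (G : sgraph T) (S : {set T}).

Definition isolated G : {set T} := [set u | nbr (adj G) setT u == set0].

Definition independent G S : bool := [disjoint inner_pairs S & edges G].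

Lemma isolated_touching G S : S \subset isolated G ->
  [disjoint touching_pairs S & edges G].
Proof.
move=> SG; apply/pred0P => e /=; apply/negP => /andP[+ eG].
have [u [v [_ eE uv]]] := edgeP eG.
rewrite inE => /andP[_ /pred0Pn[x /andP[/= xe /(subsetP SG)]]].
rewrite inE => /eqP/setP H; move: xe; rewrite eE in_set2 => /orP[] /eqP xE.
  by have := H v; rewrite !inE xE uv.
by have := H u; rewrite !inE xE adj_sym uv.
Qed.

Lemma independentS G S S' : S' \subset S -> independent G S -> independent G S'.
Proof.
move=> S'S; apply: disjointWl; apply/subsetP => e; rewrite !inE => /andP[-> eS'].
exact: subset_trans eS' S'S.
Qed.

Lemma card_touching_pairs_ge S : (#|S| * (#|T| - #|S|) <= #|touching_pairs S|)%N.
Proof.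
have pE : pairs T = inner_pairs (~: S) :|: touching_pairs S.
  apply/setP => e; rewrite !inE -andb_orr [e \subset ~: S]subsetC.
  by rewrite -disjoints_subset disjoint_sym orbN andbT.
have c1 : #|pairs T| = 'C(#|T|, 2) by rewrite /pairs card_draws.
have [c2 _] := leq_card_setU (inner_pairs (~: S)) (touching_pairs S).
rewrite -pE c1 card_inner_pairs in c2.
have cS := cardsC S; move: c2 cS; move: #|S| #|~: S| #|touching_pairs S| #|T|.
move=> k l t n c2 kl; rewrite -kl addKn.
have := bin_ffact n 2; have := bin_ffact l 2; rewrite !ffactnS !ffactn0 !muln1 (_ : 2`! = 2)%N //.
by move: c2; rewrite -kl; case: k {kl} => [//|k]; case: l => [|l]; clear; nia.
Qed.

(** Edges among the first [a] vertices get colour [true], all others [false]. In a copy of colour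
    [true] every vertex outside the clique is isolated in [G]. In a copy of colour [false] the part
    inside the clique is independent, and at most [N - a] vertices lie outside. *)
Lemma ramsey_le_two_blocks G a N : (a <= N)%N -> (ramsey G <= N)%N ->
  (#|T| <= a + #|isolated G|)%N \/
  exists2 S : {set T}, (#|T| <= #|S| + (N - a))%N & independent G S.
Proof.
move=> aN rN; pose blk (i : 'I_(ramsey G)) : bool := (i < a)%N.
have andb_sym : symmetric andb by exact: andbC.
have [f [b [fi fc]]] := ramsey_good_block andb_sym blk (ramsey_goodP G).
have fedge u v : adj G u v -> blk (f u) && blk (f v) = b.
  by move=> uv; rewrite -(fc _ uv) (pair_colour2 andb_sym) // (adj_neq uv).
pose S := [set u | blk (f u)].
have cS : (#|S| <= a)%N.
  rewrite -(card_imset _ fi) -[a]subn0; apply: card_ord_interval => i /imsetP[u].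
  by rewrite inE => ua ->.
have cSC : (#|~: S| <= N - a)%N.
  rewrite -(card_imset _ fi); apply: card_ord_interval => i /imsetP[u].
  by rewrite !inE -leqNgt => ua ->; rewrite ua (leq_trans (ltn_ord _)).
have cT := cardsC S.
case: b fc fedge => fc fedge.
  left; rewrite -cT; apply: leq_add => //; apply: subset_leq_card.
  apply/subsetP => u; rewrite !inE => uS; apply/eqP/setP => v; rewrite !inE.
  by apply/negP => /fedge; rewrite (negPf uS).
right; exists S; first by rewrite -cT leq_add2l.
apply/pred0P => e /=; apply/negP => /andP[+ eG].
have [u [v [_ eE uv]]] := edgeP eG.
rewrite inE eE subUset !sub1set !inE => /and3P[_ uS vS].
by have := fedge u v uv; rewrite uS vS.
Qed.

End TwoBlocks.

Lemma bin_ratio_le n m k : (k <= m)%N -> (m <= n)%N ->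
  ('C(n, k) * (m - k) ^ k <= n ^ k * 'C(m, k))%N.
Proof.
move=> km mn; rewrite -(leq_pmul2r (fact_gt0 k)) mulnAC bin_ffact -mulnA bin_ffact.
apply: leq_mul; rewrite ffact_prod -[X in (_ ^ X)%N]card_ord -prod_nat_const.
  by apply: leq_prod => i _; rewrite leq_subr.
by apply: leq_prod => i _; rewrite leq_sub2l // ltnW.
Qed.

Lemma bin_mul_expn4_le n t : (t <= n)%N -> ('C(n, t) * 4 ^ t <= 5 ^ n)%N.
Proof.
move=> tn; rewrite (expnDn 1 4) (bigD1 (Ordinal (tn : t < n.+1)%N)) //=.
by rewrite exp1n mul1n leq_addr.
Qed.

Section SmallDegree.
Variables (R : realType) (n : nat) (p : R).
Hypotheses (p01 : 0 <= p <= 1).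

(** A graph with [m] isolated vertices has ['C(m, k)] isolated [k]-sets, so the first moment may be
    divided by this number. For [k] well below [m], the exponent [n - k] stays near [n] and the
    ratio near [n / m]. *)
Lemma Gnp_prob_isolated m k : (k < m)%N -> (m <= n)%N ->
  Gnp_prob n p (fun G => (m <= #|isolated G|)%N) <=
    (n%:R / (m - k)%:R * (1 - p) ^+ (n - k)) ^+ k.
Proof.
move=> km mn; case/andP: (p01) => p0 p1.
have mk0 : 0 < (m - k)%:R :> R by rewrite ltr0n subn_gt0.
have C0 : 0 < 'C(m, k)%:R :> R by rewrite ltr0n bin_gt0 ltnW.
pose A := [set S : {set 'I_n} | #|S| == k].
have H1 : 'C(m, k)%:R * Gnp_prob n p (fun G => (m <= #|isolated G|)%N) <=
    \sum_(S in A) Gnp_prob n p (fun G => [disjoint touching_pairs S & edges G]).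
  apply: Gnp_prob_markov => // G mG.
  apply: leq_trans (leq_bin2l k mG) _; rewrite -cards_draws.
  apply: subset_leq_card; apply/subsetP => S; rewrite !inE => /andP[SG ->] /=.
  exact: isolated_touching.
rewrite -(ler_pM2l C0); apply: le_trans H1 _.
apply: le_trans (_ : _ <= \sum_(S in A) (1 - p) ^+ (k * (n - k))) _.
  apply: ler_sum => S; rewrite inE => /eqP cS.
  rewrite Gnp_prob_avoids; last by apply/subsetP => e; rewrite inE => /andP[].
  apply: ler_wiXn2l; rewrite ?subr_ge0 ?gerBl //.
  by have := card_touching_pairs_ge S; rewrite cS card_ord.
rewrite sumr_const card_draws card_ord -[leLHS]mulr_natl.
rewrite exprMn -exprM mulrA [((n - k) * k)%N]mulnC ler_wpM2r ?exprn_ge0 ?subr_ge0 //.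
rewrite expr_div_n mulrA ler_pdivlMr ?exprn_gt0 //.
by rewrite -!natrX -!natrM ler_nat [('C(m, k) * _)%N]mulnC bin_ratio_le // ltnW.
Qed.

Lemma Gnp_prob_independent t :
  Gnp_prob n p (fun G => [exists S : {set 'I_n}, (t <= #|S|)%N && independent G S]) <=
    'C(n, t)%:R * (1 - p) ^+ 'C(t, 2).
Proof.
case/andP: (p01) => p0 p1; pose A := [set S : {set 'I_n} | #|S| == t].
apply: le_trans (_ : _ <= \sum_(S in A) Gnp_prob n p (fun G => independent G S)) _.
  apply: Gnp_prob_union => // G /existsP[S /andP[tS iS]].
  have [S' S'S cS'] := exists_subset_card tS; exists S'; first by rewrite inE cS'.
  exact: independentS iS.
rewrite (eq_bigr (fun=> (1 - p) ^+ 'C(t, 2))) => [|S]; last first.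
  rewrite inE => /eqP cS; rewrite Gnp_prob_avoids ?card_inner_pairs ?cS //.
  by apply/subsetP => e; rewrite inE => /andP[].
by rewrite sumr_const card_draws card_ord mulr_natl.
Qed.

End SmallDegree.

(** * Failure probabilities of order [1 / n] *)

Section Tails.
Variable R : realType.
Implicit Types (d x : R) (n q : nat).

(** This weak bound turns every exponential tail below into a multiple of [1 / n], which suffices
    for the limit. *)
Lemma expR_opp_le x : 0 < x -> expR (- x) <= x^-1.
Proof.
move=> x0; rewrite expRN lef_pV2 ?posrE ?expR_gt0 //.
by apply: le_trans (expR_ge1Dx x); rewrite lerDr.
Qed.

Lemma divn_01 d n : 0 <= d -> d <= n%:R -> (0 < n)%N -> 0 <= d / n%:R <= 1.
Proof.
move=> d0 dn n0; apply/andP; split; first by rewrite divr_ge0.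
by rewrite ler_pdivrMr ?mul1r // ltr0n.
Qed.

(** The block maps number at most [expR (d * n / 10)], against a probability of at most
    [expR (2 * d - d * n / 8)], where [2 * d] absorbs lower-order terms. The difference of the rates
    is [d * n / 40]. *)
Lemma hadamard_tail d q n : 0 < d -> (20 * q)%:R <= d -> (4 <= n)%N -> d <= n%:R ->
  2%:R * (2 ^ (2 * q))%:R ^+ n * (1 - d / n%:R) ^+ (n * (n - 4) %/ 8)
    <= 80%:R * expR (2%:R * d) / d / n%:R.
Proof.
move=> d0 qd n4 dn; set k := (_ %/ 8)%N.
have n0 : 0 < n%:R :> R by rewrite ltr0n; lia.
have p01 : 0 <= d / n%:R <= 1 by apply: divn_01 (ltW d0) dn _; rewrite -(ltr0n R).
have b1 : (2 ^ (2 * q))%:R ^+ n <= expR (d * n%:R / 10%:R) :> R.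
  apply: le_trans (_ : expR 1 ^+ (2 * q * n) <= _).
    rewrite natrX -exprM lerXn2r ?nnegrE ?expR_ge0 //.
    by have := expR_ge1Dx (1 : R); lra.
  rewrite -expRM_natl mulr1 ler_expR !natrM.
  by move: qd; rewrite natrM; nra.
have b2 : (1 - d / n%:R) ^+ k <= expR (2%:R * d - d * n%:R / 8%:R).
  apply: le_trans (exprn_1B_le p01 k) _; rewrite ler_expR.
  have kn : (n * n <= 8 * k + 4 * n + 7)%N by rewrite /k mulnBr; clear; lia.
  have : (n%:R * n%:R <= 8%:R * k%:R + 4%:R * n%:R + 7%:R :> R).
    by rewrite -!natrM -!natrD ler_nat.
  have n4' : 4%:R <= n%:R :> R by rewrite ler_nat.
  move=> kn'; have : n%:R <= 8%:R * (k%:R / n%:R) + 4%:R + 7%:R / n%:R :> R.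
    rewrite -(ler_pM2r n0); apply: le_trans kn' _; rewrite le_eqVlt; apply/orP; left.
    by apply/eqP; field; rewrite gt_eqF.
  have : 7%:R / n%:R <= 7%:R / 4%:R :> R by rewrite ler_pM2l // lef_pV2 ?posrE.
  rewrite mulrAC -mulrA; move: (k%:R / n%:R) (7%:R / n%:R) => z w; nra.
apply: le_trans (ler_pM _ _ (ler_wpM2l _ b1) b2) _ => //.
- by rewrite mulr_ge0 // exprn_ge0.
- by rewrite exprn_ge0 // subr_ge0; case/andP: p01.
rewrite -mulrA -expRD.
have -> : d * n%:R / 10%:R + (2%:R * d - d * n%:R / 8%:R) =
    2%:R * d + - (d * n%:R / 40%:R) by field.
rewrite expRD; apply: le_trans (_ : _ <= 2%:R * (expR (2%:R * d) * (d * n%:R / 40%:R)^-1)) _.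
  by rewrite !ler_wpM2l ?expR_ge0 // expR_opp_le // divr_gt0 // mulr_gt0.
rewrite le_eqVlt; apply/orP; left; apply/eqP; field.
by rewrite !gt_eqF.
Qed.

(** Here [m] is about [n / 5] and [k] about [n / 100]. The two factors are at most [100 / 19] and
    [2 / 11], the latter bounding [expR (- 1.98)], and their product is below [1 - 1 / 100]. *)
Lemma isolated_tail d n : 2%:R <= d -> d <= n%:R -> (200 <= n)%N ->
  Gnp_prob n (d / n%:R) (fun G => (n - 4 * n %/ 5 <= #|isolated G|)%N)
    <= (100 * 200)%:R / n%:R.
Proof.
move=> d2 dn n200; set m := (n - _)%N; set k := (n %/ 100)%N.
have n0 : 0 < n%:R :> R by rewrite ltr0n; lia.
have p01 : 0 <= d / n%:R <= 1.
  by apply: divn_01 dn _; [apply: le_trans d2|rewrite -(ltr0n R)].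
have k0 : (0 < k)%N by rewrite divn_gt0 // (leq_trans _ n200).
have km : (k < m)%N by rewrite /k /m; move: n200; clear; lia.
have mn : (m <= n)%N by rewrite leq_subr.
apply: le_trans (Gnp_prob_isolated p01 km mn) _.
have mk0 : 0 < (m - k)%:R :> R by rewrite ltr0n subn_gt0.
have b1 : n%:R / (m - k)%:R <= 100%:R / 19%:R :> R.
  rewrite ler_pdivrMr // mulrAC ler_pdivlMr // -!natrM ler_nat.
  by rewrite /m /k; clear; lia.
have b2 : (1 - d / n%:R) ^+ (n - k) <= 2%:R / 11%:R :> R.
  apply: le_trans (exprn_1B_le p01 _) _.
  have e1 : 11%:R / 2%:R <= expR (99%:R / 50%:R : R).
    have -> : 99%:R / 50%:R = 8%:R * (99%:R / 400%:R) :> R by field.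
    rewrite expRM_natl; apply: le_trans (_ : (499%:R / 400%:R) ^+ 8 <= _).
      by lra.
    rewrite lerXn2r ?nnegrE ?expR_ge0 // ?divr_ge0 //.
    by apply: le_trans (expR_ge1Dx _); lra.
  have e2 : 99%:R / 50%:R <= d / n%:R * (n - k)%:R.
    rewrite mulrAC ler_pdivlMr // mulrAC ler_pdivrMr //.
    have kn : (99 * n <= 100 * (n - k))%N by rewrite /k; clear; lia.
    have {}kn : 99%:R * n%:R <= 100%:R * (n - k)%:R :> R by rewrite -!natrM ler_nat.
    have : 0 <= (n - k)%:R :> R by [].
    by move: (n - k)%:R kn => z; nra.
  rewrite -ler_expR in e2; rewrite expRN -[leRHS]invrK lef_pV2 ?posrE ?expR_gt0 //.
    by apply: le_trans e2; rewrite invf_div.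
  by rewrite invr_gt0 divr_gt0.
have b3 : n%:R / (m - k)%:R * (1 - d / n%:R) ^+ (n - k) <= expR (- 100%:R^-1).
  apply: le_trans (ler_pM _ _ b1 b2) _.
  - by rewrite divr_ge0.
  - by rewrite exprn_ge0 // subr_ge0; case/andP: p01.
  by apply: le_trans (expR_ge1Dx _); lra.
apply: le_trans (_ : expR (- 100%:R^-1) ^+ k <= _).
  rewrite lerXn2r ?nnegrE ?expR_ge0 // mulr_ge0 ?divr_ge0 // exprn_ge0 // subr_ge0.
  by case/andP: p01.
rewrite -expRM_natl mulrN; apply: le_trans (expR_opp_le _) _.
  by rewrite divr_gt0 // ltr0n.
rewrite invf_div ler_pdivrMr ?ltr0n //.
rewrite mulrAC ler_pdivlMr // -!natrM ler_nat /k -mulnA leq_mul2l.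
by move: n200; clear; lia.
Qed.

(** For [t] about [0.78 * n] there are at most [(5 / 4) ^ n * 4 ^ (n - t) <= expR (0.602 * n)] sets
    of size [t]. As [d >= 2], each is independent with probability at most
    [expR (1 - 0.608 * n)]. *)
Lemma independent_tail d n : 2%:R <= d -> d <= n%:R -> (200 <= n)%N ->
  Gnp_prob n (d / n%:R) (fun G => [exists S : {set 'I_n},
    (n - 11 * n %/ 50 <= #|S|)%N && independent G S])
    <= 1000%:R / 6%:R * expR 1 / n%:R.
Proof.
move=> d2 dn n200; set t := (n - _)%N.
have n0 : 0 < n%:R :> R by rewrite ltr0n; lia.
have p01 : 0 <= d / n%:R <= 1.
  by apply: divn_01 dn _; [apply: le_trans d2|rewrite -(ltr0n R)].
have tn : (t <= n)%N by rewrite leq_subr.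
apply: le_trans (Gnp_prob_independent n p01 t) _.
have t78 : (78 * n <= 100 * t)%N by rewrite /t; clear; lia.
have t1 : (0 < t)%N by move: t78 n200; clear; lia.
have {t78}t78 : 78%:R * n%:R <= 100%:R * t%:R :> R by rewrite -!natrM ler_nat.
have e4 : 4%:R <= expR (8%:R / 5%:R : R).
  rewrite expRM_natl; apply: le_trans (_ : (6%:R / 5%:R) ^+ 8 <= _); first by lra.
  rewrite lerXn2r ?nnegrE ?expR_ge0 // ?divr_ge0 //.
  by apply: le_trans (expR_ge1Dx _); lra.
have b1 : 'C(n, t)%:R <= expR (n%:R * 4%:R^-1 + (n - t)%:R * (8%:R / 5%:R)) :> R.
  rewrite expRD (expRM_natl n) (expRM_natl (n - t)).
  apply: le_trans (_ : (5%:R / 4%:R) ^+ n * 4%:R ^+ (n - t) <= _); last first.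
    apply: ler_pM; rewrite ?exprn_ge0 ?divr_ge0 //.
      rewrite lerXn2r ?nnegrE ?expR_ge0 ?divr_ge0 //.
      by apply: le_trans (expR_ge1Dx _); lra.
    by rewrite lerXn2r ?nnegrE ?expR_ge0.
  have -> : (5%:R / 4%:R) ^+ n * 4%:R ^+ (n - t) = 5%:R ^+ n / 4%:R ^+ t :> R.
    rewrite expr_div_n -mulrA; congr (_ * _).
    rewrite -[X in (4%:R ^+ X)^-1 * _](subnK tn) exprD invfM mulrAC mulVf ?mul1r //.
    by rewrite expf_neq0 // pnatr_eq0.
  rewrite ler_pdivlMr ?exprn_gt0 // -!natrX -natrM ler_nat.
  exact: bin_mul_expn4_le.
have b2 : (1 - d / n%:R) ^+ 'C(t, 2) <= expR (1 - 608%:R / 1000%:R * n%:R).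
  apply: le_trans (exprn_1B_le p01 _) _; rewrite ler_expR.
  have c2 : 2%:R * 'C(t, 2)%:R = t%:R * (t%:R - 1) :> R.
    have -> : t%:R - 1 = (t.-1)%:R :> R by rewrite -(natrB _ t1) subn1.
    rewrite -!natrM; congr (_%:R).
    have := bin_ffact t 2; rewrite !ffactnS !ffactn0 !muln1 (_ : 2`! = 2)%N //.
    by rewrite mulnC.
  have pd : 2%:R / n%:R <= d / n%:R by rewrite ler_pM2r ?invr_gt0.
  apply: le_trans (_ : - (2%:R / n%:R * 'C(t, 2)%:R) <= _).
    by rewrite lerN2 ler_wpM2r.
  rewrite mulrAC c2 -(ler_pM2r n0) mulNr divfK ?gt_eqF //.
  have n1 : 200%:R <= n%:R :> R by rewrite ler_nat.
  by move: t78 n1; move: (t%:R) (n%:R) => z w; nra.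
apply: le_trans (ler_pM _ _ b1 b2) _ => //.
  by rewrite exprn_ge0 // subr_ge0; case/andP: p01.
rewrite -expRD; apply: le_trans (_ : expR (1 + - (6%:R / 1000%:R * n%:R)) <= _).
  rewrite ler_expR natrB //; move: t78; clear; lra.
rewrite expRD; apply: le_trans (ler_wpM2l (expR_ge0 _) (expR_opp_le _)) _.
  by rewrite mulr_gt0 // divr_gt0.
rewrite mulrC [leRHS]mulrAC ler_wpM2r ?expR_ge0 // invfM invf_div.
by rewrite ler_wpM2r ?invr_ge0 //; lra.
Qed.

Lemma ramsey_small_tail d n : 2%:R <= d -> d <= n%:R -> (200 <= n)%N ->
  Gnp_prob n (d / n%:R) (fun G => (ramsey G <= 4 * n %/ 5 + 11 * n %/ 50)%N)
    <= ((100 * 200)%:R + 1000%:R / 6%:R * expR 1) / n%:R.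
Proof.
move=> d2 dn n200.
have n0 : 0 < n%:R :> R by rewrite ltr0n; lia.
have p01 : 0 <= d / n%:R <= 1.
  by apply: divn_01 dn _; [apply: le_trans d2|rewrite -(ltr0n R)].
apply: le_trans (_ : _ <= \sum_(b in [set: bool]) Gnp_prob n (d / n%:R) (fun G =>
    if b then (n - 4 * n %/ 5 <= #|isolated G|)%N
    else [exists S : {set 'I_n}, (n - 11 * n %/ 50 <= #|S|)%N && independent G S])) _.
  apply: Gnp_prob_union => // G /(ramsey_le_two_blocks (leq_addr _ _)).
  rewrite card_ord addKn => -[H|[S H iS]].
    by exists true; rewrite ?inE // leq_subLR.
  exists false; rewrite ?inE //; apply/existsP; exists S.
  by rewrite iS andbT leq_subLR addnC.
rewrite (eq_bigl xpredT) ?big_bool /=; last by move=> b; rewrite inE.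
by rewrite mulrDl lerD // ?isolated_tail ?independent_tail.
Qed.

End Tails.

From mathcomp Require Import all_classical all_reals all_analysis.
Import numFieldNormedType.Exports.

Local Open Scope ring_scope.

(** * Choice of the constants and the limit *)

Section Main.
Variable R : realType.
Implicit Types (d : R) (n q L : nat).

Lemma powR2_nat n : 2 `^ n%:R = (2 ^ n)%:R :> R.
Proof. by rewrite powR_mulrn // natrX. Qed.

Lemma ln2_gt0 : 0 < ln 2 :> R.
Proof. by rewrite ln_gt0 // ltr1n. Qed.

Lemma ln2_le1 : ln 2 <= 1 :> R.
Proof.
rewrite -ler_expR lnK ?posrE //.
by have := expR_ge1Dx (1 : R); lra.
Qed.

(** Rounding [d] up to a power of 2 makes the upper bound a pure power of 2. The factor 2 on the
    logarithm comes from [log2 d >= 1]. *)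
Lemma exists_pow2 d : 2%:R <= d -> exists L, [/\ (0 < L)%N, d <= (2 ^ L)%:R,
  (2 ^ L)%:R <= 2%:R * d & L%:R <= 2%:R * log2 d].
Proof.
move=> d2; have d0 : 0 < d by apply: lt_le_trans d2.
have l1 : 1 <= log2 d.
  by rewrite /log2 ler_pdivlMr ?ln2_gt0 // mul1r ler_ln ?posrE.
have l0 : 0 <= log2 d by apply: le_trans l1.
have dE : 2 `^ log2 d = d.
  by rewrite /powR /log2 gt_eqF // divfK ?gt_eqF ?ln2_gt0 // lnK ?posrE.
have /andP[tl lt] := truncn_itv l0.
exists (Num.truncn (log2 d)).+1; split=> //.
- rewrite -powR2_nat -{1}dE ler_powR ?ler1n //; exact: ltW.
- rewrite expnS natrM ler_pM2l // -powR2_nat -{2}dE ler_powR ?ler1n //.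
- by rewrite -natr1; lra.
Qed.

Lemma exponent_le L : (0 < L)%N ->
  (2 + (L + 11) * (L + 10 + (L + 13) * (64 * 2 ^ L)) <= 11 * 1000 * (L * L * 2 ^ L))%N.
Proof.
move=> L0; have P0 : (0 < 2 ^ L)%N by rewrite expn_gt0.
move: (2 ^ L)%N P0 => P P0.
have h1 : (L + 11 <= 12 * L)%N by lia.
have LP : (L <= L * P)%N by rewrite leq_pmulr.
have h2 : (L + 10 + (L + 13) * (64 * P) <= 910 * (L * P))%N.
  have : ((L + 13) * (64 * P) <= 14 * L * (64 * P))%N by rewrite leq_mul2r; apply/orP; right; lia.
  by move: LP L0; nia.
have h3 := leq_mul h1 h2.
have h4 : (1 <= L * L * P)%N by rewrite !muln_gt0 L0.
by move: h3 h4; clear; nia.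
Qed.

Lemma tower_eq L :
  (4 * (16 * (64 * 2 ^ L) * (128 * (64 * 2 ^ L)) ^ (64 * 2 ^ L)) ^ (L + 11) =
   2 ^ (2 + (L + 11) * (L + 10 + (L + 13) * (64 * 2 ^ L))))%N.
Proof.
have -> : (16 * (64 * 2 ^ L) = 2 ^ (L + 10))%N by rewrite mulnA expnD mulnC.
have -> : (128 * (64 * 2 ^ L) = 2 ^ (L + 13))%N by rewrite mulnA expnD mulnC.
rewrite -expnM -expnD -expnM [(_ * (L + 11))%N]mulnC [RHS]expnD.
by congr (_ * _)%N.
Qed.

Lemma ramsey_upper_tail d : 2%:R <= d -> exists C n0, forall n, (n0 <= n)%N ->
  Gnp_prob n (d / n%:R) (fun G => ~~ ((ramsey G)%:R <=
     2 `^ (88%:R * 1000%:R * d * log2 d ^+ 2) * n%:R)) <= C / n%:R.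
Proof.
move=> d2; have d0 : 0 < d by apply: lt_le_trans d2.
have [L [L0 dL Ld Ll]] := exists_pow2 d2.
pose A := ((8 * 2 ^ L) ^ 5 * (2 * 2 ^ L))%N.
exists (66%:R * A%:R), (maxn (4 * A) (2 ^ L)) => n; rewrite geq_max => /andP[An Ln].
have n0 : (0 < n)%N by apply: leq_trans Ln; rewrite expn_gt0.
have dn : d <= n%:R by apply: le_trans dL _; rewrite ler_nat.
have p01 := divn_01 (ltW d0) dn n0.
have pD : d / n%:R * n%:R <= (2 ^ L)%:R by rewrite divfK // gt_eqF // ltr0n.
have D0 : (0 < 2 ^ L)%N by rewrite expn_gt0.
have Dh : (32 * (64 * 2 ^ L) <= 2 ^ (L + 11))%N.
  by rewrite mulnA expnD mulnC.
apply: le_trans (Gnp_prob_ramsey_large p01 pD n0 D0 An Dh).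
apply: Gnp_prob_sub => // G; apply: contra => rG.
set E := (2 + (L + 11) * (L + 10 + (L + 13) * (64 * 2 ^ L)))%N.
have {}rG : (ramsey G <= 2 ^ E * n)%N.
  by rewrite /E -tower_eq mulnAC.
apply: le_trans (_ : (2 ^ E * n)%:R <= _); first by rewrite ler_nat.
rewrite natrM ler_wpM2r // -powR2_nat ler_powR ?ler1n //.
(* Three factors 2, two from [L <= 2 * log2 d] and one from [2 ^ L <= 2 * d], turn 11 into 88. *)
apply: le_trans (_ : (11 * 1000 * (L * L * 2 ^ L))%:R <= _).
  by rewrite ler_nat exponent_le.
rewrite !natrM expr2.
have L2 : L%:R * L%:R <= 2%:R * log2 d * (2%:R * log2 d) by rewrite ler_pM.
have := ler_pM (mulr_ge0 (ler0n _ _) (ler0n _ _)) (ler0n _ _) L2 Ld.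
by move: (log2 d) => l; lra.
Qed.

Lemma ramsey_lower_tail d : 2%:R <= d -> exists C n0, forall n, (n0 <= n)%N ->
  Gnp_prob n (d / n%:R) (fun G => (ramsey G)%:R < 2 `^ ((100 * 100)%:R^-1 * d) * n%:R)
    <= C / n%:R.
Proof.
move=> d2; have d0 : 0 < d by apply: lt_le_trans d2.
(* For [d < 60] the claimed factor is at most [1.01], while the two blocks have sizes [4 * n / 5]
   and [11 * n / 50], together about [1.02 * n]; [n >= 200] absorbs the rounding. *)
have [d60|d60] := leP 60%:R d; last first.
  have [_ ltd] := andP (truncn_itv (ltW d0)).
  exists ((100 * 200)%:R + 1000%:R / 6%:R * expR 1), (maxn 200 (Num.truncn d).+1) => n.
  rewrite geq_max => /andP[n200 dn].
  have {}dn : d <= n%:R by apply: le_trans (ltW ltd) _; rewrite ler_nat.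
  apply: le_trans (ramsey_small_tail d2 dn n200).
  have p01 : 0 <= d / n%:R <= 1 by apply: divn_01 (ltW d0) dn _; lia.
  apply: Gnp_prob_sub => // G rG.
  have c101 : 2 `^ ((100 * 100)%:R^-1 * d) <= 101%:R / 100%:R :> R.
    rewrite /powR gt_eqF //.
    apply: le_trans (_ : expR (6%:R / 1000%:R) <= _).
      rewrite ler_expR; apply: le_trans (ler_wpM2l _ ln2_le1) _.
        by rewrite mulr_ge0 ?invr_ge0 // ltW.
      by rewrite mulr1 natrM ler_pdivrMl ?mulr_gt0 //; lra.
    rewrite -[expR _]invrK -expRN -[leRHS]invrK lef_pV2 ?posrE ?expR_gt0 ?invr_gt0 ?divr_gt0 //.
    by apply: le_trans (expR_ge1Dx _); rewrite invf_div; lra.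
  have : (ramsey G)%:R < 101%:R / 100%:R * n%:R :> R.
    by apply: lt_le_trans rG _; rewrite ler_wpM2r.
  rewrite mulrAC ltr_pdivlMr // -!natrM ltr_nat.
  by move: n200; clear; lia.
have d20 : 0 <= d / 20%:R by rewrite divr_ge0 // ltW.
have /andP[qd dq] := truncn_itv d20.
(* The ground set has [2 * q] elements. The tail estimate asks for [20 * q <= d], and [q >= 3] makes
   [q - 2] exceed [d / 10000]. *)
set q := Num.truncn (d / 20%:R) in qd dq.
have q3 : (3 <= q)%N.
  by rewrite -ltnS -(ltr_nat R); apply: le_lt_trans dq; rewrite ler_pdivlMr // -natrM.
have {}qd : (20 * q)%:R <= d by rewrite natrM mulrC -ler_pdivlMr.
have {}dq : d < 20%:R * q.+1%:R by rewrite mulrC -ltr_pdivrMr.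
have [_ ltd] := andP (truncn_itv (ltW d0)).
exists (80%:R * expR (2%:R * d) / d), (maxn (2 ^ (q + 2)) (Num.truncn d).+1) => n.
rewrite geq_max => /andP[qn dn].
have {}dn : d <= n%:R by apply: le_trans (ltW ltd) _; rewrite ler_nat.
have n4 : (4 <= n)%N.
  by apply: leq_trans qn; rewrite expnD leq_pmull // expn_gt0.
have p01 : 0 <= d / n%:R <= 1 by apply: divn_01 (ltW d0) dn _; lia.
(* This is the largest block size that Lindsey's lemma admits here; the [2 ^ (2 * q)] blocks hold
   about [2 ^ (q - 1) * n] vertices. *)
pose s := (n %/ 2 ^ q.+1)%N.
have P0 : (0 < 2 ^ q)%N by rewrite expn_gt0.
have s0 : (0 < s)%N.
  rewrite divn_gt0 ?expn_gt0 //; apply: leq_trans qn.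
  by rewrite leq_exp2l // addn2 ltnW.
have sn : (s * (2 * 2 ^ q) <= n)%N by rewrite -expnS leq_divM.
have s4 : (4 * s ^ 2 * 2 ^ (2 * q) <= n ^ 2)%N.
  rewrite (_ : _ * _ = (s * (2 * 2 ^ q)) ^ 2)%N ?leq_exp2r //.
  by rewrite mulnC expnM mulnC -expnM [(2 * q)%N]mulnC expnM !expnMn; clear; lia.
apply: le_trans (hadamard_tail d0 qd n4 dn).
apply: le_trans (Gnp_prob_ramsey_le_hadamard p01 s0 s4).
apply: Gnp_prob_sub => // G rG.
(* The exponent is [q - 2] because rounding in [s] may cost a factor 2. *)
have : (ramsey G)%:R < (2 ^ (q - 2) * n)%:R :> R.
  apply: lt_le_trans rG _; rewrite (natrM _ (2 ^ (q - 2)) n) ler_wpM2r // -powR2_nat ler_powR ?ler1n //.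
  rewrite natrB; last exact: ltnW.
  rewrite ler_pdivrMl; last by rewrite ltr0n.
  have q3' : 3%:R <= q%:R :> R by rewrite ler_nat.
  by move: dq q3'; rewrite -natr1 natrM; clear; lra.
rewrite ltr_nat => /ltnW rn; apply: leq_trans rn _.
have sn2 : (n < s.+1 * (2 * 2 ^ q))%N by rewrite -expnS ltn_ceil // expn_gt0.
have qE : (2 ^ q = 4 * 2 ^ (q - 2))%N.
  by rewrite -{1}(subnKC (ltnW q3)) expnD.
rewrite mul2n -addnn expnD [leqRHS]mulnC.
move: qn sn2; rewrite expnD qE; move: (2 ^ (q - 2))%N => Q; clear => Qn sn.
have {sn}sn : (n <= 16 * Q * s)%N by lia.
by apply: leq_trans (leq_mul (leqnn Q) sn) _; lia.
Qed.

End Main.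

Local Open Scope classical_set_scope.

Theorem theorem1p4 (R : realType) :
  exists c1 c2 : R, 0 < c1 /\ 0 < c2 /\
    forall d : R, 2 <= d ->
      (fun n : nat => Gnp_prob n (d / n%:R) (fun G : sgraph 'I_n =>
         2 `^ (c1 * d) * n%:R <= (ramsey G)%:R
           <= 2 `^ (c2 * d * log2 d ^+ 2) * n%:R)) @ \oo --> (1 : R).
Proof.
exists (100 * 100)%:R^-1, (88%:R * 1000%:R); split; first by rewrite invr_gt0 ltr0n.
split; first by apply: mulr_gt0; rewrite ltr0n.
move=> d d2; have [C1 [n1 H1]] := ramsey_lower_tail d2.
have [C2 [n2 H2]] := ramsey_upper_tail d2.
have d0 : 0 < d by apply: lt_le_trans d2.
apply/cvgrPdist_le => eps eps0.
(* The tail lemmas leave the signs of [C1] and [C2] open, whence the absolute values. *)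
pose C := `|C1| + `|C2|.
near=> n.
have n0 : (0 < n)%N by near: n; exact: nbhs_infty_gt.
have n0' : 0 < n%:R :> R by rewrite ltr0n.
have dn : d <= n%:R.
  have [_ /ltW ltd] := andP (truncn_itv (ltW d0)); apply: le_trans ltd _.
  by rewrite ler_nat; near: n; exact: nbhs_infty_ge.
have Cn : C / n%:R <= eps.
  rewrite ler_pdivrMr // mulrC -ler_pdivrMr //.
  have C0 : 0 <= C / eps by rewrite divr_ge0 ?addr_ge0 // ltW.
  have [_ /ltW ltC] := andP (truncn_itv C0); apply: le_trans ltC _.
  by rewrite ler_nat; near: n; exact: nbhs_infty_ge.
have n1n : (n1 <= n)%N by near: n; exact: nbhs_infty_ge.
have n2n : (n2 <= n)%N by near: n; exact: nbhs_infty_ge.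
have p01 := divn_01 (ltW d0) dn n0.
set E := (fun G : sgraph 'I_n => _).
(* It remains to bound the probability that one of the two inequalities fails, by the sum of the two
   tails. *)
have -> : 1 - Gnp_prob n (d / n%:R) E = Gnp_prob n (d / n%:R) (fun G => ~~ E G).
  by apply/eqP; rewrite subr_eq addrC Gnp_probC.
rewrite ger0_norm ?Gnp_prob_ge0 //.
apply: le_trans (_ : C1 / n%:R + C2 / n%:R <= _); last first.
  apply: le_trans Cn; rewrite -mulrDl ler_wpM2r ?invr_ge0 //.
  by rewrite lerD // ler_norm.
apply: le_trans (lerD (H1 n n1n) (H2 n n2n)).
set E1 := (X in Gnp_prob _ _ X + _); set E2 := (X in _ + Gnp_prob _ _ X).
apply: le_trans (_ : _ <= \sum_(b in [set: bool]%SET)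
    Gnp_prob n (d / n%:R) (fun G => if b then E1 G else E2 G)) _.
  apply: Gnp_prob_union => // G; rewrite /E negb_and -ltNge => /orP[EG|EG].
    by exists true; rewrite ?inE.
  by exists false; rewrite ?inE.
by rewrite (eq_bigl xpredT) ?big_bool //= => b; rewrite inE.
Unshelve. all: end_near.
Qed.
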